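(* Let $G$ be a finite group acting by $\psi$ on a small category $\mathcal C$ in which every sequence of composable non-identity morphisms has length at most some fixed number, let $K$ be a finite abelian group, and let $F\colon\mathcal C\to K\text{-}\mathrm{Top}_*$ be a homotopy coherent diagram with an external action of $G$ compatible with $\psi$. Let $H$ be a subgroup of $G$. Then the $H$-fixed-point set $(\mathrm{hocolim}\,F)^H$ is the homotopy colimit of the homotopy coherent diagram $F^H\colon\mathcal C^H\to K\text{-}\mathrm{Top}_*$ with $F^H(u)=F(u)^H$ and with morphisms defined as follows: for a sequence of composable morphisms $(f_i,\dots,f_1)$ of $\mathcal C^H$, with $u$ the domain of $f_1$, the map $F^H(f_i,\dots,f_1)(t_1,\dots,t_{i-1})$ is the restriction of $F(f_i,\dots,f_1)(t_1,\dots,t_{i-1})$ to $F(u)^H$.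
   Context: $K\text{-}\mathrm{Top}_*$ is the category of well-based spaces with a continuous action of the finite group $K$ (inclusions of fixed-point sets being cofibrations) and equivariant maps. A $G$-action on a small category $\mathcal C$ is an action $\psi$ on objects with bijections $\psi_g\colon\mathrm{Hom}(x,y)\to\mathrm{Hom}(\psi_gx,\psi_gy)$ compatible with composition, identities, and multiplication in $G$. $\mathcal C^H$ is the subcategory of $\mathcal C$ of $H$-invariant objects and $H$-invariant arrows. A homotopy coherent diagram $F\colon\mathcal C\to K\text{-}\mathrm{Top}_*$ assigns to each object $x$ a space $F(x)$ and to each composable sequence $x_0\xrightarrow{f_1}\cdots\xrightarrow{f_n}x_n$, $n\ge1$, a continuous $K$-equivariant map $F(f_n,\dots,f_1)\colon[0,1]^{n-1}\times F(x_0)\to F(x_n)$ sending $[0,1]^{n-1}\times\{*\}$ to $*$. In a category without non-identity isomorphisms (as here) one may use only non-identity morphisms, and the requirements are: if $t_i=0$, $F(f_n,\dots,f_1)(t_1,\dots,t_{n-1})=F(f_n,\dots,f_{i+1})(t_{i+1},\dots,t_{n-1})\circ F(f_i,\dots,f_1)(t_1,\dots,t_{i-1})$; if $t_i=1$, it equals $F(f_n,\dots,f_{i+1}\circ f_i,\dots,f_1)(t_1,\dots,\hat t_i,\dots,t_{n-1})$. Its homotopy colimit is $$\mathrm{hocolim}\,F=\{*\}\amalg\coprod_{n\ge0}\ \coprod_{x_0\xrightarrow{f_1}\cdots\xrightarrow{f_n}x_n,\ f_i\ne\mathrm{Id}}[0,1]^n\times F(x_0)\Big/\sim,$$ where $(f_n,\dots,f_1;t_1,\dots,t_n;y)$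 is identified with $(f_n,\dots,f_{i+1};t_{i+1},\dots,t_n;F(f_i,\dots,f_1)(t_1,\dots,t_{i-1},y))$ if $t_i=0$; with $(f_n,\dots,f_{i+1}\circ f_i,\dots,f_1;t_1,\dots,\hat t_i,\dots,t_n;y)$ if $t_i=1$, $i<n$; with $(f_{n-1},\dots,f_1;t_1,\dots,t_{n-1};y)$ if $t_n=1$; and with $*$ if $y=*$. An external action $\bar\psi$ of $G$ on $F$ compatible with $\psi$ is a homomorphism $\bar\psi\colon G\to\mathrm{Homeo}\big(\bigvee_{c\in\mathrm{Ob}(\mathcal C)}F(c)\big)$, preserving the basepoint, commuting with the $K$-action, and lifting the action of $G$ on $\mathrm{Ob}(\mathcal C)$ (so $\bar\psi_g$ maps $F(c)$ to $F(\psi_gc)$), such that for all $g\in G$, $y\in F(c)$, $$\bar\psi_g\big(F(f_i,\dots,f_1)(t_1,\dots,t_{i-1})(y)\big)=F(\psi_gf_i,\dots,\psi_gf_1)(t_1,\dots,t_{i-1})(\bar\psi_gy).$$ Then $G$ acts on $\mathrm{hocolim}\,F$ by $g(f_m,\dots,f_1;t_1,\dots,t_m;y)=(\psi_gf_m,\dots,\psi_gf_1;t_1,\dots,t_m;\bar\psi_gy)$, and for $u\in\mathrm{Ob}(\mathcal C^H)$ the group $H$ acts on $F(u)$ via $\bar\psi$, with fixed set $F(u)^H$.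
   Formalization: Spaces are taken to be Hausdorff, and that each F(u)^H is well-based with cofibrant fixed-point inclusions (lies in K-Top_* ) is claimed only if F(u)^H ∩ F(u)^L → F(u) is a cofibration for all u in C^H, L ≤ K; without these the statement fails. *)

(* Defs.v *)
From HB Require Import structures.
From Stdlib Require Import Relation_Operators.
From mathcomp Require Import all_boot all_order all_algebra all_fingroup.
From mathcomp Require Import generic_quotient.
From mathcomp Require Import all_classical all_reals all_analysis.
From mathcomp Require Import wedge_sigT.

Set Implicit Arguments.
Unset Strict Implicit.
Unset Printing Implicit Defensive.

Import Order.TTheory GRing.Theory Num.Theory.
Import numFieldNormedType.Exports.

Local Open Scope classical_set_scope.
Local Open Scope ring_scope.
Local Open Scope quotient_scope.

Definition unitI (R : realType) : topologicalType :=
  set_type (`[0%R, 1%R]%classic : set R).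

Lemma unitI0_subproof (R : realType) :
  (0 : R) \in (`[0%R, 1%R]%classic : set R).
Proof. by apply/mem_set; rewrite /= in_itv /= lexx ler01. Qed.

Definition unitI0 (R : realType) : unitI R := exist _ 0 (unitI0_subproof R).

Definition cube (R : realType) (n : nat) : topologicalType :=
  {ptws 'I_n -> unitI R}.

(* Points of cubes are presented by infinite sequences [u], of which only the
   first [n] terms are used: the coordinate [t_i] is [u i.-1].  Every point of
   [cube R n] is of the form [coords n u], see [coordsK]. *)
Definition coords (R : realType) (n : nat) (u : nat -> unitI R) : cube R n :=
  fun i => u i.

Arguments coords {R} n u.

Definition pad (R : realType) (n : nat) (t : cube R n) : nat -> unitI R :=
  fun i => if insub i is Some j then t j else unitI0 R.

Lemma coordsK (R : realType) (n : nat) (t : cube R n) : coords n (pad t) = t.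
Proof.
apply/funext => i; rewrite /coords /pad.
by case: insubP => [j _ /val_inj -> //|]; rewrite ltn_ord.
Qed.

Lemma pad_coords (R : realType) (n : nat) (u : nat -> unitI R) (i : nat) :
  (i < n)%N -> pad (coords n u) i = u i.
Proof. by move=> lin; rewrite /pad insubT. Qed.

(* (t_1, t_2, ...) |-> (t_{i+1}, t_{i+2}, ...) *)
Definition dropc (R : realType) (i : nat) (u : nat -> unitI R) :=
  fun j => u (i + j)%N.

(* removal of the term [u i], that is of the coordinate t_{i+1} *)
Definition delc (R : realType) (i : nat) (u : nat -> unitI R) :=
  fun j => if (j < i)%N then u j else u j.+1.

(* The homotopy extension property of the inclusion of [A] in [X]. *)
Definition cofibration (R : realType) (X : topologicalType) (A : set X) :=
  forall (Y : topologicalType) (f : X -> Y) (h : unitI R * A -> Y),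
    continuous f -> continuous h ->
    (forall a : A, h (unitI0 R, a) = f (val a)) ->
  exists h' : unitI R * X -> Y,
    [/\ continuous h',
        forall x, h' (unitI0 R, x) = f x
      & forall s (a : A), h' (s, val a) = h (s, a)].

Definition homeomorphism (X Y : topologicalType) (f : X -> Y) :=
  continuous f /\
  exists g : Y -> X, [/\ continuous g, cancel f g & cancel g f].

(* Spaces are Hausdorff.  As [K] is finite, an action is continuous as soon as
   each of its elements acts by a continuous map. *)
Record kspace (K : finGroupType) := KSpace {
  ksort :> topologicalType;
  basept : ksort;
  kact : K -> ksort -> ksort;
  kspace_hausdorff : hausdorff_space ksort;
  kact_continuous : forall k, continuous (kact k);
  kact1 : forall y, kact 1%g y = y;
  kactM : forall k l y, kact (k * l)%g y = kact k (kact l y);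
  kact_basept : forall k, kact k basept = basept }.

Definition kfix (K : finGroupType) (X : kspace K) (L : {group K}) : set X :=
  [set y | forall k, k \in L -> kact k y = y].

(* the objects of K-Top_* *)
Definition KTop (R : realType) (K : finGroupType) (X : kspace K) :=
  cofibration R [set basept X] /\
  forall L : {group K}, cofibration R (kfix (X := X) L).

(* [ccomp g f] is "g after f"; its value is irrelevant unless [cod f = dom g]. *)
Record smallcat := SmallCat {
  obj : choiceType;
  mor : choiceType;
  dom : mor -> obj;
  cod : mor -> obj;
  idm : obj -> mor;
  ccomp : mor -> mor -> mor;
  dom_idm : forall x, dom (idm x) = x;
  cod_idm : forall x, cod (idm x) = x;
  dom_comp : forall g f, cod f = dom g -> dom (ccomp g f) = dom f;
  cod_comp : forall g f, cod f = dom g -> cod (ccomp g f) = cod g;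
  comp_idl : forall f, ccomp (idm (cod f)) f = f;
  comp_idr : forall f, ccomp f (idm (dom f)) = f;
  comp_assoc : forall h g f, cod f = dom g -> cod g = dom h ->
    ccomp h (ccomp g f) = ccomp (ccomp h g) f }.

(* The bijectivity of Hom(x, y) -> Hom(psi_g x, psi_g y) follows from
   [amor1] and [amorM]. *)
Record cat_action (G : finGroupType) (C : smallcat) := CatAction {
  aobj : G -> obj C -> obj C;
  amor : G -> mor C -> mor C;
  aobj1 : forall x, aobj 1%g x = x;
  aobjM : forall g h x, aobj (g * h)%g x = aobj g (aobj h x);
  amor1 : forall f, amor 1%g f = f;
  amorM : forall g h f, amor (g * h)%g f = amor g (amor h f);
  dom_amor : forall g f, dom (amor g f) = aobj g (dom f);
  cod_amor : forall g f, cod (amor g f) = aobj g (cod f);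
  amor_idm : forall g x, amor g (idm x) = idm (aobj g x);
  amor_comp : forall g f2 f1, cod f1 = dom f2 ->
    amor g (ccomp f2 f1) = ccomp (amor g f2) (amor g f1) }.

Section FixedCategory.
Context (G : finGroupType) (C : smallcat) (A : cat_action G C) (H : {group G}).

Definition inv_obj (x : obj C) := [forall h in H, aobj A h x == x].
Definition inv_mor (f : mor C) := [forall h in H, amor A h f == f].

Lemma inv_objP x : reflect (forall h, h \in H -> aobj A h x = x) (inv_obj x).
Proof. exact: 'forall_in_eqP. Qed.

Lemma inv_morP f : reflect (forall h, h \in H -> amor A h f = f) (inv_mor f).
Proof. exact: 'forall_in_eqP. Qed.

Lemma inv_dom f : inv_mor f -> inv_obj (dom f).
Proof. by move=> /inv_morP fH; apply/inv_objP => h /fH; rewrite -dom_amor => ->. Qed.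

Lemma inv_cod f : inv_mor f -> inv_obj (cod f).
Proof. by move=> /inv_morP fH; apply/inv_objP => h /fH; rewrite -cod_amor => ->. Qed.

Lemma inv_idm x : inv_obj x -> inv_mor (idm x).
Proof. by move=> /inv_objP xH; apply/inv_morP => h /xH; rewrite amor_idm => ->. Qed.

Lemma inv_comp g f : cod f = dom g ->
  inv_mor g -> inv_mor f -> inv_mor (ccomp g f).
Proof.
move=> e /inv_morP gH /inv_morP fH; apply/inv_morP => h hH.
by rewrite amor_comp // gH // fH.
Qed.

Let fobj : choiceType := {x : obj C | inv_obj x}.
Let fmor : choiceType := {f : mor C | inv_mor f}.

Let fdom (f : fmor) : fobj := exist _ (dom (val f)) (inv_dom (valP f)).
Let fcod (f : fmor) : fobj := exist _ (cod (val f)) (inv_cod (valP f)).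
Let fidm (x : fobj) : fmor := exist _ (idm (val x)) (inv_idm (valP x)).
Let fcomp (g f : fmor) : fmor := insubd g (ccomp (val g) (val f)).

Let val_fcomp g f : fcod f = fdom g -> val (fcomp g f) = ccomp (val g) (val f).
Proof.
move=> /(congr1 val) /= e; rewrite /fcomp val_insubd.
by rewrite (inv_comp e (valP g) (valP f)).
Qed.

Let fdom_idm x : fdom (fidm x) = x.
Proof. by apply/val_inj; rewrite /= dom_idm. Qed.

Let fcod_idm x : fcod (fidm x) = x.
Proof. by apply/val_inj; rewrite /= cod_idm. Qed.

Let fdom_comp g f : fcod f = fdom g -> fdom (fcomp g f) = fdom f.
Proof.
move=> e; apply/val_inj; rewrite [LHS]/= val_fcomp // dom_comp //.
exact: (congr1 val e).
Qed.

Let fcod_comp g f : fcod f = fdom g -> fcod (fcomp g f) = fcod g.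
Proof.
move=> e; apply/val_inj; rewrite [LHS]/= val_fcomp // cod_comp //.
exact: (congr1 val e).
Qed.

Let fcomp_idl f : fcomp (fidm (fcod f)) f = f.
Proof. by apply/val_inj; rewrite val_fcomp ?fdom_idm //= comp_idl. Qed.

Let fcomp_idr f : fcomp f (fidm (fdom f)) = f.
Proof. by apply/val_inj; rewrite val_fcomp ?fcod_idm //= comp_idr. Qed.

Let fcomp_assoc h g f : fcod f = fdom g -> fcod g = fdom h ->
  fcomp h (fcomp g f) = fcomp (fcomp h g) f.
Proof.
move=> e1 e2; apply/val_inj; rewrite !val_fcomp ?fcod_comp ?fdom_comp //.
by rewrite comp_assoc //; [exact: (congr1 val e1)|exact: (congr1 val e2)].
Qed.

(* C^H *)
Definition fixed_cat : smallcat :=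
  SmallCat fdom_idm fcod_idm fdom_comp fcod_comp fcomp_idl fcomp_idr
    fcomp_assoc.

Definition fobj_val (x : obj fixed_cat) : obj C := val (x : fobj).
Definition fmor_val (f : mor fixed_cat) : mor C := val (f : fmor).

End FixedCategory.

Section Chains.
Context (C : smallcat).

Fixpoint composable (x : obj C) (s : seq (mor C)) : bool :=
  if s is f :: s' then (dom f == x) && composable (cod f) s' else true.

(* [nchain x [:: f_1; ...; f_n]] : x -f_1-> ... -f_n-> x_n, all f_i <> Id *)
Definition nchain (x : obj C) (s : seq (mor C)) : bool :=
  composable x s && all (fun f => f != idm (dom f)) s.

Definition target (x : obj C) (s : seq (mor C)) : obj C :=
  last x (map (@cod C) s).

Definition chain : choiceType :=
  {c : obj C * seq (mor C) | nchain c.1 c.2}.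

Definition bounded_chains : Prop :=
  exists N : nat, forall x s, nchain x s -> (size s <= N)%N.

End Chains.

Section Diagrams.
Context (R : realType) (K : finGroupType) (C : smallcat).
Context (Fo : obj C -> kspace K).

(* [tot y] is [y] regarded as a point of the disjoint union of all [Fo x]; it
   makes it possible to compare points of [Fo x] and [Fo x'] when [x] and [x'] are equal,
   but not definitionally so. *)
Definition tot (x : obj C) (y : Fo x) : {x : obj C & Fo x} := existT _ x y.

Lemma tot_inj (x : obj C) : injective (@tot x).
Proof. by move=> y z e; exact: (existT_inj2 e). Qed.

(* The maps F(f_n, ..., f_1) : [0,1]^{n-1} x F(x_0) -> F(x_n); the values on
   [(x, s)] are irrelevant unless [s] is nonempty and [nchain x s]. *)
Definition hc_maps := forall (x : obj C) (s : seq (mor C)),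
  cube R (size s).-1 -> Fo x -> Fo (target x s).

Record hc_diagram (Fm : hc_maps) : Prop := HcDiagram {
  hc_continuous : forall x s, nchain x s -> (0 < size s)%N ->
    continuous (fun p : cube R (size s).-1 * Fo x => Fm x s p.1 p.2);
  hc_equivariant : forall x s t k (y : Fo x), nchain x s -> (0 < size s)%N ->
    Fm x s t (kact k y) = kact k (Fm x s t y);
  hc_basept : forall x s t, nchain x s -> (0 < size s)%N ->
    Fm x s t (basept (Fo x)) = basept (Fo (target x s));
  (* t_i = 0, with s1 = (f_1, ..., f_i) and s2 = (f_{i+1}, ..., f_n) *)
  hc_face0 : forall x s1 s2 (u : nat -> unitI R) (y : Fo x), nchain x (s1 ++ s2) ->
    (0 < size s1)%N -> (0 < size s2)%N -> val (u (size s1).-1) = 0 ->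
    tot (Fm x (s1 ++ s2) (coords _ u) y) =
    tot (Fm (target x s1) s2 (coords _ (dropc (size s1) u))
           (Fm x s1 (coords _ u) y));
  (* t_i = 1, with f = f_i and g = f_{i+1} *)
  hc_face1 : forall x s1 f g s2 (u : nat -> unitI R) (y : Fo x),
    nchain x (s1 ++ f :: g :: s2) -> val (u (size s1)) = 1 ->
    tot (Fm x (s1 ++ f :: g :: s2) (coords _ u) y) =
    tot (Fm x (s1 ++ ccomp g f :: s2) (coords _ (delc (size s1) u)) y) }.

(* The components of {*} + coprod_n coprod_(x_0 -> ... -> x_n) [0,1]^n x F(x_0);
   [None] is the index of the component {*}. *)
Definition hoc_cell (o : option (chain C)) : topologicalType :=
  if o is Some c then (cube R (size (val c).2) * Fo (val c).1)%type
  else discrete_topology unit.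

Definition hoc_pre : topologicalType := {o : option (chain C) & hoc_cell o}.

Definition pre_pt : hoc_pre := existT hoc_cell None tt.

(* (f_n, ..., f_1; t_1, ..., t_n; y) *)
Definition pre_cell (x : obj C) (s : seq (mor C)) (xs : nchain x s)
    (u : nat -> unitI R) (y : Fo x) : hoc_pre :=
  existT hoc_cell (Some (exist _ (x, s) xs)) (coords (size s) u, y).

Inductive hoc_gen (Fm : hc_maps) : hoc_pre -> hoc_pre -> Prop :=
| hoc_face0 x s1 s2 (c : nchain x (s1 ++ s2)) (c2 : nchain (target x s1) s2)
    (u : nat -> unitI R) (y : Fo x) : (0 < size s1)%N -> val (u (size s1).-1) = 0 ->
    hoc_gen Fm (pre_cell c u y)
      (pre_cell c2 (dropc (size s1) u) (Fm x s1 (coords _ u) y))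
| hoc_face1 x s1 f g s2 (c : nchain x (s1 ++ f :: g :: s2))
    (c' : nchain x (s1 ++ ccomp g f :: s2)) (u : nat -> unitI R) (y : Fo x) :
    val (u (size s1)) = 1 ->
    hoc_gen Fm (pre_cell c u y) (pre_cell c' (delc (size s1) u) y)
| hoc_last x s f (c : nchain x (rcons s f)) (c' : nchain x s)
    (u : nat -> unitI R) (y : Fo x) :
    val (u (size s)) = 1 ->
    hoc_gen Fm (pre_cell c u y) (pre_cell c' u y)
| hoc_base x s (c : nchain x s) u :
    hoc_gen Fm (pre_cell c u (basept (Fo x))) pre_pt.

Section Hocolim.
Context (Fm : hc_maps).

Let hoc_rel (a b : hoc_pre) : bool :=
  `[< clos_refl_sym_trans _ (hoc_gen Fm) a b >].

Let hoc_rel_refl : reflexive hoc_rel.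
Proof. by move=> a; apply/asboolP; exact: rst_refl. Qed.

Let hoc_rel_sym : symmetric hoc_rel.
Proof. by move=> a b; apply/asboolP/asboolP => ?; exact: rst_sym. Qed.

Let hoc_rel_trans : transitive hoc_rel.
Proof. by move=> b a c /asboolP ab /asboolP bc; apply/asboolP/(rst_trans _ _ _ b). Qed.

Definition hoc_equiv := EquivRel hoc_rel hoc_rel_refl hoc_rel_sym hoc_rel_trans.

Definition hocolim : topologicalType := quotient_topology {eq_quot hoc_equiv}.

Definition hoc_class (a : hoc_pre) : hocolim := \pi_({eq_quot hoc_equiv}) a.

Definition hoc_repr (p : hocolim) : hoc_pre :=
  repr (p : {eq_quot hoc_equiv}).

Lemma hoc_reprK p : hoc_class (hoc_repr p) = p.
Proof. exact: reprK. Qed.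

Lemma hoc_classP a b :
  hoc_class a = hoc_class b <-> clos_refl_sym_trans _ (hoc_gen Fm) a b.
Proof. by split=> [/eqmodP/asboolP|ab]; last apply/eqmodP/asboolP. Qed.

Lemma hoc_liftE (m : hoc_pre -> hoc_pre) a :
  (forall b c, hoc_gen Fm b c ->
     clos_refl_sym_trans _ (hoc_gen Fm) (m b) (m c)) ->
  hoc_class (m (hoc_repr (hoc_class a))) = hoc_class (m a).
Proof.
move=> mP; apply/hoc_classP.
have /hoc_classP : hoc_class (hoc_repr (hoc_class a)) = hoc_class a.
  exact: hoc_reprK.
move: (hoc_repr _) => r; elim=> [b c /mP //|b|b c _|b c d _ bc _ cd]; first exact: rst_refl.
- exact: rst_sym.
- exact: rst_trans bc cd.
Qed.

Definition pre_kact (k : K) (a : hoc_pre) : hoc_pre :=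
  let: existT o b := a in
  match o return hoc_cell o -> hoc_pre with
  | Some c => fun b => existT hoc_cell (Some c) (b.1, kact k b.2)
  | None => fun b => existT hoc_cell None b
  end b.

Definition hoc_kact (k : K) (p : hocolim) : hocolim :=
  hoc_class (pre_kact k (hoc_repr p)).

Lemma hoc_kactE (FmP : hc_diagram Fm) k a :
  hoc_class (pre_kact k a) = hoc_kact k (hoc_class a).
Proof.
apply/esym/hoc_liftE => _ _ []; intros; apply: rst_step => /=.
- rewrite -/(pre_cell c u (kact k y)).
  have c1 : nchain x s1.
    move: c; rewrite /nchain all_cat => /andP[+ /andP[-> _]]; rewrite andbT.
    by elim: (s1) (x) => //= f s IH z /andP[-> /IH].
  by rewrite -hc_equivariant //; exact: hoc_face0.
- exact: (hoc_face1 Fm c c' (kact k y)).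
- exact: (hoc_last Fm c c' (kact k y)).
- by rewrite kact_basept; exact: (hoc_base Fm c u).
Qed.

End Hocolim.
End Diagrams.

Arguments tot {K C} Fo {x} y.
Arguments pre_cell {R K C} Fo {x s} xs u y.

Section External.
Context (R : realType) (G K : finGroupType) (C : smallcat).
Context (A : cat_action G C) (Fo : obj C -> kspace K) (Fm : hc_maps R Fo).
Arguments Fm : clear implicits.

Definition wedgeF : topologicalType := wedge (fun c => basept (Fo c)).

Definition inw (c : obj C) (y : Fo c) : wedgeF :=
  wedge_lift (fun c => basept (Fo c)) y.

(* [wact] is the homomorphism from [G] to the homeomorphisms of the wedge, and
   [wcomp g] consists of the maps F(c) -> F(psi_g c) which [wact g] induces. *)
Record ext_action := ExtAction {
  wact : G -> wedgeF -> wedgeF;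
  wact_continuous : forall g, continuous (wact g);
  wact1 : forall w, wact 1%g w = w;
  wactM : forall g h w, wact (g * h)%g w = wact g (wact h w);
  wact_basept : forall g c,
    wact g (inw (basept (Fo c))) = inw (basept (Fo c));
  wcomp : forall g [c], Fo c -> Fo (aobj A g c);
  wact_inw : forall g c (y : Fo c), wact g (inw y) = inw (wcomp g y);
  wcomp_kact : forall g c k (y : Fo c),
    wcomp g (kact k y) = kact k (wcomp g y);
  wcomp_hc : forall g x s (u : nat -> unitI R) (y : Fo x),
    nchain x s -> (0 < size s)%N ->
    tot Fo (wcomp g (Fm x s (coords _ u) y)) =
    tot Fo (Fm (aobj A g x) (map (amor A g) s) (coords _ u) (wcomp g y)) }.

Lemma inw_eq c d (y : Fo c) (z : Fo d) : inw y = inw z ->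
  tot Fo y = tot Fo z \/ y = basept (Fo c) /\ z = basept (Fo d).
Proof.
by move=> /eqmodP/predU1P[|/andP[/eqP ? /eqP ?]]; [left|right].
Qed.

Lemma amor_inj g : injective (amor A g).
Proof.
by move=> f f' /(congr1 (amor A g^-1%g)); rewrite -!amorM mulVg !amor1.
Qed.

Lemma nchain_amor g x s : nchain x s ->
  nchain (aobj A g x) (map (amor A g) s).
Proof.
rewrite /nchain => /andP[sc sn]; apply/andP; split.
  elim: s x sc {sn} => //= f s IH x /andP[/eqP <- /IH].
  by rewrite dom_amor eqxx cod_amor.
rewrite all_map; apply: sub_all sn => f /=; apply: contra => /eqP.
by rewrite dom_amor -amor_idm => /amor_inj e; apply/eqP.
Qed.

Section Act.
Context (E : ext_action).

Lemma wcomp_basept g c : wcomp E g (basept (Fo c)) = basept (Fo (aobj A g c)).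
Proof.
have := wact_basept E g c; rewrite wact_inw => /inw_eq[|[]//].
suff tot_basept d (z : Fo d) : tot Fo z = tot Fo (basept (Fo c)) ->
    z = basept (Fo d) by exact: tot_basept.
move=> e; have /= ed := congr1 (@projT1 _ _) e.
by case: _ / (esym ed) z e => z /tot_inj.
Qed.

(* g (f_m, ..., f_1; t_1, ..., t_m; y)
     = (psi_g f_m, ..., psi_g f_1; t_1, ..., t_m; g y) *)
Definition pre_gact (g : G) (a : hoc_pre R Fo) : hoc_pre R Fo :=
  let: existT o b := a in
  match o return hoc_cell R Fo o -> hoc_pre R Fo with
  | Some c => fun b =>
      pre_cell Fo (nchain_amor g (valP c)) (pad b.1) (wcomp E g b.2)
  | None => fun b => existT (hoc_cell R Fo) None b
  end b.

Lemma pre_cell_eq x s x' s' (c : nchain x s) (c' : nchain x' s')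
    (u u' : nat -> unitI R) (y : Fo x) (y' : Fo x') :
  s = s' -> (forall i, (i < size s)%N -> u i = u' i) ->
  tot Fo y = tot Fo y' -> pre_cell Fo c u y = pre_cell Fo c' u' y'.
Proof.
move=> es; case: _ / es c' => c' uu e.
have /= ex := congr1 (@projT1 _ _) e.
case: _ / ex y' c' e => y' c' /tot_inj <-; rewrite (bool_irrelevance c' c).
rewrite /pre_cell (_ : coords _ u = coords _ u') //.
by apply/funext => i; exact: uu.
Qed.

Lemma pre_gactE g x s (c : nchain x s) (u : nat -> unitI R) (y : Fo x)
    (c' : nchain (aobj A g x) (map (amor A g) s)) :
  pre_gact g (pre_cell Fo c u y) = pre_cell Fo c' u (wcomp E g y).
Proof.
apply: pre_cell_eq => // i; rewrite size_map => ?.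
exact: pad_coords.
Qed.

Definition hoc_gact (g : G) (p : hocolim Fm) : hocolim Fm :=
  hoc_class Fm (pre_gact g (hoc_repr p)).

Lemma target_amor g x s :
  target (aobj A g x) (map (amor A g) s) = aobj A g (target x s).
Proof. by elim: s x => //= f s IH x; rewrite /target /= cod_amor; exact: IH. Qed.

Lemma hoc_gactE (FmP : hc_diagram Fm) g a :
  hoc_class Fm (pre_gact g a) = hoc_gact g (hoc_class Fm a).
Proof.
apply/esym/hoc_liftE => _ _ []; intros; apply: rst_step.
- have c1 : nchain x s1.
    move: c; rewrite /nchain all_cat => /andP[+ /andP[-> _]]; rewrite andbT.
    by elim: (s1) (x) => //= f s IH z /andP[-> /IH].
  have gc := nchain_amor g c; have gc2 := nchain_amor g c2.
  rewrite !(pre_gactE _ _ _ gc, pre_gactE _ _ _ gc2).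
  have gc' : nchain (aobj A g x)
      (map (amor A g) s1 ++ map (amor A g) s2) by rewrite -map_cat.
  have gc2' : nchain (target (aobj A g x) (map (amor A g) s1))
      (map (amor A g) s2) by rewrite target_amor.
  have -> : pre_cell Fo gc u (wcomp E g y) = pre_cell Fo gc' u (wcomp E g y).
    by apply: pre_cell_eq => //; rewrite map_cat.
  have -> : pre_cell Fo gc2 (dropc (size s1) u)
        (wcomp E g (Fm x s1 (coords (size s1).-1 u) y)) =
      pre_cell Fo gc2' (dropc (size (map (amor A g) s1)) u)
        (Fm (aobj A g x) (map (amor A g) s1) (coords _ u) (wcomp E g y)).
    apply: pre_cell_eq => //; first by move=> j _; rewrite size_map.
    exact: wcomp_hc.
  by apply: hoc_face0; rewrite size_map.
- have gc := nchain_amor g c; have gc2 := nchain_amor g c'.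
  rewrite !(pre_gactE _ _ _ gc, pre_gactE _ _ _ gc2).
  have cfg : cod f = dom g0.
    move: c; rewrite /nchain => /andP[+ _].
    by elim: (s1) (x) => /= [|? ? IH] ? /andP[_]; [case/andP=> /eqP-> |exact: IH].
  have gc' : nchain (aobj A g x) (map (amor A g) s1 ++
      amor A g f :: amor A g g0 :: map (amor A g) s2).
    by move: gc; rewrite map_cat.
  have gc2' : nchain (aobj A g x) (map (amor A g) s1 ++
      ccomp (amor A g g0) (amor A g f) :: map (amor A g) s2).
    by move: gc2; rewrite map_cat /= amor_comp.
  have -> : pre_cell Fo gc u (wcomp E g y) = pre_cell Fo gc' u (wcomp E g y).
    by apply: pre_cell_eq => //; rewrite map_cat.
  have -> : pre_cell Fo gc2 (delc (size s1) u) (wcomp E g y) =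
      pre_cell Fo gc2' (delc (size (map (amor A g) s1)) u) (wcomp E g y).
    apply: pre_cell_eq; rewrite ?map_cat /= ?amor_comp // => j _.
    by rewrite size_map.
  by apply: hoc_face1; rewrite size_map.
- have gc := nchain_amor g c; have gc2 := nchain_amor g c'.
  rewrite !(pre_gactE _ _ _ gc, pre_gactE _ _ _ gc2).
  have gc' : nchain (aobj A g x) (rcons (map (amor A g) s) (amor A g f)).
    by rewrite -map_rcons.
  have -> : pre_cell Fo gc u (wcomp E g y) = pre_cell Fo gc' u (wcomp E g y).
    by apply: pre_cell_eq => //; rewrite map_rcons.
  by apply: hoc_last; rewrite size_map.
- rewrite (pre_gactE _ _ _ (nchain_amor g c)) wcomp_basept.
  exact: hoc_base.
Qed.

(* (hocolim F)^H *)
Definition hoc_fix (H : {group G}) : set (hocolim Fm) :=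
  [set p | forall h, h \in H -> hoc_gact h p = p].

(* F(u)^H *)
Definition ffix (H : {group G}) (u : obj C) : set (Fo u) :=
  [set y | forall h, h \in H -> wact E h (inw y) = inw y].

Arguments ffix H u : clear implicits.

Section FixedSpace.
Context (H : {group G}) (u : obj C).

Let fsort : topologicalType := set_type (ffix H u).

Let fbase_subproof : basept (Fo u) \in ffix H u.
Proof. by apply/mem_set => h _; exact: wact_basept. Qed.

Let fbase : fsort := exist _ (basept (Fo u)) fbase_subproof.

Let fkact_subproof k (y : fsort) : kact k (val y) \in ffix H u.
Proof.
case: y => y /= /set_mem yH; apply/mem_set => h /yH.
rewrite !wact_inw wcomp_kact; move: (wcomp E h y) => z /inw_eq[zy|[-> ->]].
  have /= e := congr1 (@projT1 _ _) zy.
  by case: _ / (esym e) z zy => z /tot_inj ->.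
by rewrite !kact_basept; exact: wedge_liftE.
Qed.

Let fkact k (y : fsort) : fsort := exist _ (kact k (val y)) (fkact_subproof k y).

Let fhausdorff : hausdorff_space fsort.
Proof.
move=> y z yz; apply/val_inj; apply: (@kspace_hausdorff _ (Fo u)) => B D By Dz.
have valc : continuous (val : fsort -> Fo u) by exact: initial_continuous.
have [w [? ?]] := yz _ _ (valc _ _ By) (valc _ _ Dz).
by exists (val w).
Qed.

Let fkact_continuous k : continuous (fkact k).
Proof.
apply: continuous_comp_initial => y.
apply: (@continuous_comp _ _ _ (val : fsort -> Fo u) (kact k)).
  exact: initial_continuous.
exact: kact_continuous.
Qed.

Let fkact1 y : fkact 1%g y = y.
Proof. by apply/val_inj; exact: kact1. Qed.

Let fkactM k l y : fkact (k * l)%g y = fkact k (fkact l y).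
Proof. by apply/val_inj; exact: kactM. Qed.

Let fkact_base k : fkact k fbase = fbase.
Proof. by apply/val_inj; exact: kact_basept. Qed.

Definition fixed_space : kspace K :=
  KSpace fhausdorff fkact_continuous fkact1 fkactM fkact_base.

Definition fixed_val (y : fixed_space) : Fo u := val (y : ffix H u).

End FixedSpace.

Definition fixed_diag (H : {group G}) (u : obj (fixed_cat A H)) : kspace K :=
  fixed_space H (fobj_val u).

End Act.
End External.

Arguments ffix {R G K C A Fo Fm} E H u.
Arguments hoc_fix {R G K C A Fo Fm} E H.
Arguments fixed_space {R G K C A Fo Fm} E H u.
Arguments fixed_diag {R G K C A Fo Fm} E H u.

(* Main.v *)
(* Every point of hocolim F has a unique reduced representative: the base point,
   or (f_n, ..., f_1; t_1, ..., t_n; y) with all t_i in ]0, 1[ and y <> *.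
   Existence follows by applying the face relations, which shorten chains;
   bounded chains ensure that composites of non-identities are non-identities.
   For uniqueness, cut a representative after its last zero coordinate, apply F
   to the first part, and compose out the coordinates equal to 1 in the second
   part: the result does not change under the relations.  As G acts on reduced
   representatives, a reduced representative of an H-fixed point is itself
   H-fixed, so that hocolim F^H -> (hocolim F)^H is a bijection.

   It is a closed map: if B is closed in hocolim F^H and S is its image, the
   trace of S on a cell is the union of a closed set of H-fixed points, which
   contains all the reduced points of the trace, and of the traces on the base
   point and on the faces, which are closed by induction on the dimension.

   The spaces F(u)^H are well-based because, for closed B c A c X such that A
   and B are cofibrations in X, B is a cofibration in A: a retraction for B moves
   a point of A within a neighbourhood that a retraction for A pushes back into A,
   provided the homotopy is stopped in time. *)

From HB Require Import structures.
Require Import Defs.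
From Stdlib Require Import Relation_Operators.
From mathcomp Require Import all_boot all_order all_algebra all_fingroup.
From mathcomp Require Import all_classical all_reals all_analysis.
From mathcomp Require Import wedge_sigT lra.
(* [dom] and [cod] must denote the operations of [smallcat]. *)
Import Defs.

Set Implicit Arguments.
Unset Strict Implicit.
Unset Printing Implicit Defensive.

Import Order.TTheory GRing.Theory Num.Theory.
Import numFieldNormedType.Exports.

Local Open Scope classical_set_scope.
Local Open Scope ring_scope.

(** * Reduced representatives *)

Section Coordinates.
Context {R : realType}.
Implicit Types u v : nat -> unitI R.

Lemma dropcD i j u : dropc i (dropc j u) = dropc (j + i) u.
Proof. by apply/funext => k; rewrite /dropc addnA. Qed.

Lemma dropc_delc i u : dropc i (delc i u) = dropc i.+1 u.
Proof. by apply/funext => k; rewrite /dropc /delc ltnNge leq_addr. Qed.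

(** The index is the 1-based one of the coordinates [t_i], with 0 for no zero at all; it thus counts
    the arrows to which F has to be applied. *)
Fixpoint last_zero n u : nat :=
  if n is n'.+1 then if val (u n') == 0 then n else last_zero n' u else 0.

Lemma eq_last_zero n u v :
  (forall i, (i < n)%N -> u i = v i) -> last_zero n u = last_zero n v.
Proof.
elim: n => //= n IH uv; rewrite uv // IH // => i lin.
by apply: uv; exact: ltnW.
Qed.

Lemma last_zero_le n u : (last_zero n u <= n)%N.
Proof. by elim: n => //= n IH; case: ifP => // _; exact: leqW. Qed.

Lemma last_zeroD m n u : last_zero (m + n) u =
  if last_zero n (dropc m u) is k.+1 then (m + k.+1)%N else last_zero m u.
Proof.
elim: n => [|n IH]; first by rewrite addn0.
by rewrite addnS /= {1}/dropc; case: ifP; rewrite ?addnS.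
Qed.

End Coordinates.

(** * Chains labelled by their coordinates *)

Section Collapse.
Context {R : realType} {C : smallcat}.
Implicit Types (f g : mor C) (s : seq (mor C)) (u : nat -> unitI R).

(** A list without dependent types, so that cells over different chains can be compared by plain
    equality. *)
Fixpoint labels s u : seq (mor C * R) :=
  if s is f :: s' then (f, val (u 0)) :: labels s' (dropc 1 u) else [::].

Lemma labels_cat s1 s2 u :
  labels (s1 ++ s2) u = labels s1 u ++ labels s2 (dropc (size s1) u).
Proof.
elim: s1 u => [|f s1 IH] u //=.
by rewrite IH dropcD.
Qed.

Lemma eq_labels s u v :
  (forall i, (i < size s)%N -> u i = v i) -> labels s u = labels s v.
Proof.
elim: s u v => //= f s IH u v uv; rewrite uv //; congr (_ :: _).
by apply: IH => i lis; rewrite /dropc; exact: uv.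
Qed.

Lemma labels_inj s s' u v : labels s u = labels s' v ->
  s = s' /\ forall i, (i < size s)%N -> u i = v i.
Proof.
elim: s s' u v => [|f s IH] [|f' s'] u v //= [-> /val_inj uv /IH[<- {}IH]].
by split=> // -[//|i] /IH.
Qed.

(* Composes out the arrows labelled 1 and drops a trailing one; [(f, t)] is the
   pending first arrow. *)
Fixpoint collapse_from f (t : R) (l : seq (mor C * R)) : seq (mor C * R) :=
  if t == 1 then
    if l is (g, t') :: l' then collapse_from (ccomp g f) t' l' else [::]
  else (f, t) :: if l is (g, t') :: l' then collapse_from g t' l' else [::].

Definition collapse (l : seq (mor C * R)) : seq (mor C * R) :=
  if l is (f, t) :: l' then collapse_from f t l' else [::].

Lemma collapse_id (l : seq (mor C * R)) :
  all (fun p => p.2 != 1) l -> collapse l = l.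
Proof.
case: l => //= -[f t] l; elim: l f t => [|[g t'] l IH] f t /=.
  by rewrite andbT => /negbTE ->.
by move=> /andP[/negbTE -> /IH ->].
Qed.

Lemma collapse_last (l : seq (mor C * R)) f :
  collapse (rcons l (f, 1)) = collapse l.
Proof.
case: l => [|[g t] l] /=; first by rewrite eqxx.
elim: l g t => [|[g' t'] l IH] g t /=; first by rewrite eqxx.
by rewrite !IH.
Qed.

Fixpoint lcomposable (x : obj C) (l : seq (mor C * R)) : bool :=
  if l is (f, _) :: l' then (dom f == x) && lcomposable (cod f) l' else true.

Lemma lcomposable_labels x s u : lcomposable x (labels s u) = composable x s.
Proof. by elim: s x u => //= f s IH x u; rewrite IH. Qed.

(** If the arrow [f0] before [f] is pending with label 1, one side yields [g (f f0)] and the other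
    [(g f) f0]. Associativity holds for composable arrows only, hence the hypothesis; the induction
    generalizes over the pending arrow, which may itself be a composite. *)
Lemma collapse_comp x (l1 l2 : seq (mor C * R)) f g (t : R) :
  lcomposable x (l1 ++ (f, 1) :: (g, t) :: l2) ->
  collapse (l1 ++ (f, 1) :: (g, t) :: l2) =
  collapse (l1 ++ (ccomp g f, t) :: l2).
Proof.
case: l1 => [|[f0 t0] l1] /=; first by rewrite eqxx.
move=> /andP[_].
elim: l1 f0 t0 => [|[f1 t1] l1 IH] f0 t0 /=.
  move=> /and3P[/eqP ff0 /eqP gf _].
  by rewrite eqxx comp_assoc.
move=> /andP[/eqP f1f0 l]; rewrite !IH //.
by rewrite cod_comp.
Qed.

End Collapse.

Section NchainTheory.
Context {C : smallcat}.
Implicit Types (x : obj C) (f g : mor C) (s : seq (mor C)).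

Lemma composable_cat x s1 s2 :
  composable x (s1 ++ s2) = composable x s1 && composable (target x s1) s2.
Proof. by elim: s1 x => //= f s1 IH x; rewrite IH andbA. Qed.

Lemma nchain_cat x s1 s2 :
  nchain x (s1 ++ s2) = nchain x s1 && nchain (target x s1) s2.
Proof. by rewrite /nchain composable_cat all_cat andbACA. Qed.

(* If [ccomp g f] were an identity, then (f, g, f, g, ...) would be an
   arbitrarily long chain. *)
Lemma ccomp_neq_id f g : bounded_chains C -> cod f = dom g ->
  f != idm (dom f) -> g != idm (dom g) ->
  ccomp g f != idm (dom (ccomp g f)).
Proof.
move=> [N HN] fg fN gN; apply/eqP => e.
have gf : cod g = dom f.
  by rewrite -(cod_comp fg) e cod_idm dom_comp.
have ch n : nchain (dom f) (iter n (fun s => f :: g :: s) [::]).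
  elim: n => //= n /andP[cn an]; rewrite /nchain /= fN gN an !andbT.
  by rewrite eqxx fg eqxx gf.
have := HN _ _ (ch N.+1).
suff -> : size (iter N.+1 (fun s => f :: g :: s) [::]) = (N.+1).*2.
  by rewrite leqNgt -addnn addSn ltnS leq_addr.
by elim: (N.+1) => //= n ->; rewrite doubleS.
Qed.

Lemma nchain_ccomp x s1 f g s2 : bounded_chains C ->
  nchain x (s1 ++ f :: g :: s2) -> nchain x (s1 ++ ccomp g f :: s2).
Proof.
move=> bC; rewrite !nchain_cat => /andP[-> /=].
rewrite /nchain /= => /andP[/and3P[/eqP df /eqP dg c2] /and3P[nf ng n2]].
by rewrite ccomp_neq_id // dom_comp // cod_comp // df eqxx c2 n2.
Qed.

End NchainTheory.

(** * Invariance of the normal form under the relations *)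

Section NormalForms.
Context (R : realType) (K : finGroupType) (C : smallcat).
Context (Fo : obj C -> kspace K) (Fm : hc_maps R Fo).
Hypothesis FmP : hc_diagram Fm.
Arguments Fm : clear implicits.

Lemma tot_basept_eq x x' : x = x' ->
  tot Fo (basept (Fo x)) = tot Fo (basept (Fo x')).
Proof. by move=> ->. Qed.

Lemma eq_tot_basept x x' (y : Fo x) (y' : Fo x') : tot Fo y = tot Fo y' ->
  y = basept (Fo x) -> y' = basept (Fo x').
Proof.
move=> e; have /= ex := congr1 (@projT1 _ _) e.
by case: _ / ex y' e => y' /tot_inj <-.
Qed.

(** F is applied to the arrows up to the last zero coordinate; that coordinate itself is not an
    argument of F. The object reached depends on [u], hence the value in the total space. *)
Definition start x (s : seq (mor C)) (u : nat -> unitI R) (y : Fo x) :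
    {x : obj C & Fo x} :=
  if last_zero (size s) u is k.+1
  then tot Fo (Fm x (take k.+1 s) (coords _ u) y) else tot Fo y.

Lemma start_take x s (u : nat -> unitI R) (y : Fo x) k :
  last_zero (size s) u = k -> (0 < k)%N ->
  start s u y = tot Fo (Fm x (take k s) (coords _ u) y).
Proof. by rewrite /start => ->; case: k. Qed.

(** [None] encodes the base point of the homotopy colimit, whatever chain remains after the cut. *)
Definition cell_nf x (s : seq (mor C)) (u : nat -> unitI R) (y : Fo x) :
    option ({x : obj C & Fo x} * seq (mor C * R)) :=
  let k := last_zero (size s) u in
  if `[< projT2 (start s u y) = basept _ >] then None
  else Some (start s u y, collapse (labels (drop k s) (dropc k u))).

Definition nf (a : hoc_pre R Fo) :=
  let: existT o b := a in
  match o return hoc_cell R Fo o -> option ({x : obj C & Fo x} * seq (mor C * R)) with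
  | Some c => fun b => cell_nf (val c).2 (pad b.1) b.2
  | None => fun _ => None
  end b.

Lemma eq_start x s (u v : nat -> unitI R) (y : Fo x) :
  (forall i, (i < size s)%N -> u i = v i) -> start s u y = start s v y.
Proof.
move=> uv; rewrite /start -(eq_last_zero uv).
case E : (last_zero _ _) => [//|k].
have ks : (k < size s)%N by have := last_zero_le (size s) u; rewrite E.
suff -> : coords (size (take k.+1 s)).-1 u = coords _ v by [].
apply/funext => i; apply: uv; apply: leq_trans (ltn_ord i) _.
by rewrite size_takel //= ltnW.
Qed.

Lemma eq_cell_nf x s (u v : nat -> unitI R) (y : Fo x) :
  (forall i, (i < size s)%N -> u i = v i) -> cell_nf s u y = cell_nf s v y.
Proof.
move=> uv; rewrite /cell_nf (eq_start _ uv) (eq_last_zero uv).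
case: asboolP => // _; congr (Some (_, collapse _)); apply: eq_labels => i.
rewrite size_drop ltn_subRL => ?; exact: uv.
Qed.

Lemma nf_pre_cell x s (c : nchain x s) (u : nat -> unitI R) (y : Fo x) :
  nf (pre_cell Fo c u y) = cell_nf s u y.
Proof. by apply: eq_cell_nf => i lis; rewrite pad_coords. Qed.

Lemma cell_nf_eq x s (u : nat -> unitI R) (y : Fo x)
    x' s' (u' : nat -> unitI R) (y' : Fo x') :
  start s u y = start s' u' y' ->
  collapse (labels (drop (last_zero (size s) u) s)
     (dropc (last_zero (size s) u) u)) =
  collapse (labels (drop (last_zero (size s') u') s')
     (dropc (last_zero (size s') u') u')) ->
  cell_nf s u y = cell_nf s' u' y'.
Proof. by move=> e1 e2; rewrite /cell_nf e1 e2. Qed.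

(** The last zero is either the given one, where both sides have applied F to [s1], or a later one,
    where the coherence of F at [t_i = 0] factors the first map through the second. *)
Lemma nf_face0 x s1 s2 (u : nat -> unitI R) (y : Fo x) :
  nchain x (s1 ++ s2) ->
  (0 < size s1)%N -> val (u (size s1).-1) = 0 ->
  cell_nf (s1 ++ s2) u y =
  cell_nf s2 (dropc (size s1) u) (Fm x s1 (coords _ u) y).
Proof.
move=> c s1_gt0 us1.
have l1 : last_zero (size s1) u = size s1.
  by move: us1; case: (size s1) s1_gt0 => //= n _ ->; rewrite eqxx.
have := last_zeroD (size s1) (size s2) u.
rewrite l1 -size_cat.
case E : (last_zero (size s2) (dropc (size s1) u)) => [|k] E'; apply: cell_nf_eq.
- by rewrite (start_take _ E') // take_size_cat // /start E.
- by rewrite E E' drop_size_cat // drop0.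
- rewrite (start_take _ E') ?addnS // (start_take _ E) // -addnS.
  rewrite take_cat ltnNge leq_addr /= addKn.
  have ks2 : (k < size s2)%N.
    by have := last_zero_le (size s2) (dropc (size s1) u); rewrite E.
  apply: hc_face0 => //; last by rewrite size_takel.
  by move: c; rewrite -{1}(cat_take_drop k.+1 s2) catA nchain_cat => /andP[].
- by rewrite E E' drop_cat ltnNge leq_addr /= addKn dropcD.
Qed.

(** A coordinate 1 after the last zero is absorbed by [collapse_comp]; before the last zero it is an
    argument of F, and the coherence of F at [t_i = 1] applies. *)
Lemma nf_face1 x s1 f g s2 (u : nat -> unitI R) (y : Fo x) :
  nchain x (s1 ++ f :: g :: s2) -> val (u (size s1)) = 1 ->
  cell_nf (s1 ++ f :: g :: s2) u y =
  cell_nf (s1 ++ ccomp g f :: s2) (delc (size s1) u) y.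
Proof.
move=> c us1; set m := size s1 in us1 *.
have ld : last_zero m (delc m u) = last_zero m u.
  by apply: eq_last_zero => i; rewrite /delc => ->.
have lS : last_zero m.+1 u = last_zero m u by rewrite /= us1 oner_eq0.
have := last_zeroD m (size s2).+1 (delc m u).
have := last_zeroD m.+1 (size s2).+1 u.
rewrite lS ld dropc_delc.
have -> : (m.+1 + (size s2).+1 = size (s1 ++ f :: g :: s2))%N.
  by rewrite size_cat /= addSnnS.
have -> : (m + (size s2).+1 = size (s1 ++ ccomp g f :: s2))%N.
  by rewrite size_cat.
case E : (last_zero _ (dropc m.+1 u)) => [|k] E1 E2; apply: cell_nf_eq.
- have := last_zero_le m u.
  rewrite /start E1 E2; case: (last_zero m u) => // k km.
  rewrite !takel_cat //; congr (tot Fo (Fm _ _ _ _)).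
  apply/funext => i; rewrite /coords /delc.
  have /= := ltn_ord i; rewrite {2}size_takel //= => ik.
  by rewrite (leq_trans _ km) // ltnS ltnW.
- have := last_zero_le m u; rewrite E1 E2.
  move: (last_zero m u) => k km; rewrite !(drop_cat, labels_cat) -/m.
  have cf : composable (target x (take k s1)) (drop k s1 ++ f :: g :: s2).
    move: c; rewrite -{1}(cat_take_drop k s1) -catA nchain_cat.
    by case/andP=> _ /andP[].
  have dk : dropc (size (drop k s1)) (dropc k (delc m u)) = dropc m (delc m u).
    by rewrite dropcD size_drop subnKC.
  have dk' : dropc (size (drop k s1)) (dropc k u) = dropc m u.
    by rewrite dropcD size_drop subnKC.
  have lk : labels (drop k s1) (dropc k (delc m u)) = labels (drop k s1) (dropc k u).
    apply: eq_labels => i; rewrite size_drop ltn_subRL => ikm.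
    by rewrite /dropc /delc ikm.
  have Hc : collapse (labels (drop k s1 ++ f :: g :: s2) (dropc k u)) =
            collapse (labels (drop k s1 ++ ccomp g f :: s2) (dropc k (delc m u))).
    move: cf; rewrite -(lcomposable_labels _ _ (dropc k u)) !labels_cat lk dk dk' /=.
    have us1' : val (dropc m u 0) = 1 by rewrite /dropc addn0.
    by rewrite dropc_delc !dropcD !addn1 us1' => /collapse_comp ->.
  (* The remaining case is that the last zero immediately precedes [f]: then [drop k s1] is empty
     and [drop_cat] takes its other branch. *)
  case: ltngtP km => // km _.
  by move: Hc; rewrite km drop_size subnn.
- have ks2 : (k <= size s2)%N.
    by have := last_zero_le (size s2).+1 (dropc m.+1 u); rewrite E.
  rewrite (start_take _ E1) // (start_take _ E2) ?addnS //.
  rewrite addSn -!addnS.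
  rewrite !take_cat -/m !ltnNge !leq_addr /= !addKn /=.
  apply: hc_face1 => //.
  move: c; rewrite -{1}(cat_take_drop k s2).
  by rewrite -!cat_cons catA nchain_cat => /andP[].
- rewrite E1 E2 addSnnS !drop_cat -/m !ltnNge !leq_addr /= !addKn /=.
  by rewrite -[dropc _ (delc _ _)]dropcD dropc_delc dropcD addSnnS.
Qed.

(** The last coordinate is not a zero, so the cut stays in place, and [collapse] drops a trailing
    1. *)
Lemma nf_last x s f (u : nat -> unitI R) (y : Fo x) : val (u (size s)) = 1 ->
  cell_nf (rcons s f) u y = cell_nf s u y.
Proof.
move=> us; have E : last_zero (size (rcons s f)) u = last_zero (size s) u.
  by rewrite size_rcons /= us oner_eq0.
have ks := last_zero_le (size s) u.
apply: cell_nf_eq; rewrite ?/start E.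
  by case: last_zero ks => // k ks; rewrite -cats1 takel_cat.
rewrite -cats1 drop_cat.
case: ltngtP ks => // [lks _|-> _]; last first.
  rewrite subnn drop0 drop_size /= /dropc addn0 us.
  by rewrite eqxx.
rewrite labels_cat /= dropcD size_drop subnKC; last exact: ltnW.
by rewrite /dropc addn0 us cats1 collapse_last.
Qed.

Lemma nf_base x s (u : nat -> unitI R) : nchain x s ->
  cell_nf s u (basept (Fo x)) = None.
Proof.
move=> c; rewrite /cell_nf; case: asboolP => // -[].
rewrite /start; case E : (last_zero _ _) => [//|k] /=.
have ks : (k < size s)%N by have := last_zero_le (size s) u; rewrite E.
apply: hc_basept => //; last by rewrite size_takel.
by move: c; rewrite -{1}(cat_take_drop k.+1 s) nchain_cat => /andP[].
Qed.

Lemma nf_hoc_gen a b : hoc_gen Fm a b -> nf a = nf b.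
Proof.
case=> *; rewrite !nf_pre_cell.
- exact: nf_face0.
- exact: nf_face1.
- exact: nf_last.
- exact: nf_base.
Qed.

Lemma nf_equiv a b : clos_refl_sym_trans _ (hoc_gen Fm) a b -> nf a = nf b.
Proof. by elim=> [? ? /nf_hoc_gen|//|//|? ? ? _ -> _]. Qed.


Inductive reduced : hoc_pre R Fo -> Prop :=
| reduced_pt : reduced (pre_pt R Fo)
| reduced_cell x s (c : nchain x s) (u : nat -> unitI R) (y : Fo x) :
    (forall i, (i < size s)%N -> val (u i) != 0 /\ val (u i) != 1) ->
    y <> basept (Fo x) -> reduced (pre_cell Fo c u y).

Lemma last_zero_eq0 n (u : nat -> unitI R) :
  (forall i, (i < n)%N -> val (u i) != 0) -> last_zero n u = 0%N.
Proof.
elim: n => //= n IH un; rewrite (negbTE (un _ _)) //; apply: IH => i lin.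
by apply: un; exact: ltnW.
Qed.

(** With no coordinate 0 or 1 nothing is cut off or composed out, so the normal form retains all the
    data of the cell; this is what makes [nf] injective on reduced points. *)
Lemma nf_reduced_cell x s (c : nchain x s) (u : nat -> unitI R) (y : Fo x) :
  (forall i, (i < size s)%N -> val (u i) != 0 /\ val (u i) != 1) ->
  y <> basept (Fo x) -> nf (pre_cell Fo c u y) = Some (tot Fo y, labels s u).
Proof.
move=> us yN; rewrite nf_pre_cell /cell_nf /start last_zero_eq0; last first.
  by move=> i /us[].
case: asboolP => // _; rewrite drop0 (_ : dropc 0 u = u) // collapse_id //.
elim: s u us {c} => //= f s IH u us; have /= [_ ->] := us 0%N isT.
rewrite /=; apply: IH => i; exact: us i.+1.
Qed.

Lemma reduced_inj a b : reduced a -> reduced b -> nf a = nf b -> a = b.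
Proof.
case=> [|x s c u y us yN] [|x' s' c' u' y' us' yN'] //;
  rewrite !nf_reduced_cell // => /Some_inj/pair_equal_spec[e /labels_inj[es uu]].
exact: pre_cell_eq.
Qed.

End NormalForms.

Lemma size2_split (T : Type) (s : seq T) i : (i.+1 < size s)%N ->
  exists s1 f g s2, s = s1 ++ f :: g :: s2 /\ size s1 = i.
Proof.
move=> lis; have := cat_take_drop i s.
have := size_takel (ltnW (ltnW lis)).
move: (take i s) (drop i s) => s1 [|f [|g s2]] si es; rewrite -es -si in lis.
- by move: lis; rewrite cats0 ltnNge leqnSn.
- by move: lis; rewrite size_cat addn1 ltnn.
- by exists s1, f, g, s2.
Qed.

(** * Existence of reduced representatives *)

Section Normalize.
Context (R : realType) (K : finGroupType) (C : smallcat).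
Context (Fo : obj C -> kspace K) (Fm : hc_maps R Fo).
Hypothesis bC : bounded_chains C.
Arguments Fm : clear implicits.

(** Induction on the length of the chain: a coordinate 0 cuts off a nonempty initial part, an inner
    coordinate 1 merges two arrows, a final 1 removes one. Bounded chains enter through
    [nchain_ccomp], which keeps the merged arrow different from an identity. *)
Lemma exists_reduced a :
  exists2 b, reduced b & clos_refl_sym_trans _ (hoc_gen Fm) a b.
Proof.
have step p q : hoc_gen Fm p q ->
    (exists2 b, reduced b & clos_refl_sym_trans _ (hoc_gen Fm) q b) ->
    exists2 b, reduced b & clos_refl_sym_trans _ (hoc_gen Fm) p b.
  move=> pq [b nb qb]; exists b => //; apply: rst_trans qb; exact: rst_step.
have cellP n : forall x s (c : nchain x s) (u : nat -> unitI R) (y : Fo x),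
    (size s <= n)%N ->
    exists2 b, reduced b & clos_refl_sym_trans _ (hoc_gen Fm) (pre_cell Fo c u y) b.
  elim: n => [|n IH] x s c u y sn.
    have [->|/eqP yN] := eqVneq y (basept (Fo x)).
      by apply: step (hoc_base Fm c u) _; exists (pre_pt R Fo); [left|exact: rst_refl].
    exists (pre_cell Fo c u y); last exact: rst_refl.
    by right=> // i; move: sn; rewrite leqn0 => /eqP ->.
  have [->|/eqP yN] := eqVneq y (basept (Fo x)).
    by apply: step (hoc_base Fm c u) _; exists (pre_pt R Fo); [left|exact: rst_refl].
  have [[i lis /eqP ui]|no0] := pselect (exists2 i, (i < size s)%N & val (u i) == 0).
    have si := size_takel lis.
    have c2 : nchain x (take i.+1 s ++ drop i.+1 s) by rewrite cat_take_drop.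
    have -> : pre_cell Fo c u y = pre_cell Fo c2 u y.
      by apply: pre_cell_eq; rewrite ?cat_take_drop.
    have c3 : nchain (target x (take i.+1 s)) (drop i.+1 s).
      by move: (c2); rewrite nchain_cat => /andP[].
    apply: step (hoc_face0 Fm c2 c3 y _ _) _; rewrite ?si //.
    by apply: IH; rewrite size_drop leq_subLR addSn (leq_trans sn) // ltnS leq_addl.
  have [[i lis /eqP ui]|no1] := pselect (exists2 i, (i < size s)%N & val (u i) == 1).
    have [lis2|] := ltnP i.+1 (size s).
      have [s1 [f [g [s2 [es si]]]]] := size2_split lis2.
      subst s i.
      apply: step (hoc_face1 Fm c (nchain_ccomp bC c) y ui) _.
      by apply: IH; move: sn; rewrite !size_cat /= addnS.
    case/lastP: s c sn lis {no0} => // s f c; rewrite size_rcons => sn lis si.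
    have {si} ei : i = size s.
      by apply/eqP; rewrite eqn_leq; apply/andP; split; [exact: lis|exact: si].
    have c' : nchain x s by move: c; rewrite -cats1 nchain_cat => /andP[].
    subst i; apply: step (hoc_last Fm c c' y ui) _; exact: IH.
  exists (pre_cell Fo c u y); last exact: rst_refl.
  right=> // i lis; split; apply/negP => ui; first by apply: no0; exists i.
  by apply: no1; exists i.
case: a => -[[[x s] c] [t y]|[]]; last first.
  by exists (pre_pt R Fo); [left|exact: rst_refl].
rewrite -(coordsK t); exact: cellP.
Qed.

End Normalize.

(** * Closed subsets of the homotopy colimit *)

Section Continuity.

Lemma cube_continuous (R : realType) n (X : topologicalType) (f : X -> cube R n) :
  (forall i, continuous (fun x => f x i)) -> continuous f.
Proof.
move=> fc x; apply/cvg_sup => i.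
apply: (@continuous_comp_initial _ _ _ (proj i) f); exact: fc.
Qed.

Lemma coord_continuous (R : realType) n (i : 'I_n) :
  continuous (fun t : cube R n => t i).
Proof. exact: proj_continuous. Qed.

Lemma pad_continuous (R : realType) n i :
  continuous (fun t : cube R n => pad t i).
Proof.
rewrite /pad; case: insub => [j|]; first exact: coord_continuous.
exact: cst_continuous.
Qed.

Lemma pair_continuous (X Y Z : topologicalType) (f : X -> Y) (g : X -> Z) :
  continuous f -> continuous g -> continuous (fun x => (f x, g x)).
Proof. by move=> fc gc x; apply: cvg_pair; [exact: fc|exact: gc]. Qed.

Lemma set_val_continuous (X : topologicalType) (A : set X) :
  continuous (set_val : A -> X).
Proof. exact: initial_continuous. Qed.

Lemma fst_continuous (X Y : topologicalType) : continuous (@fst X Y).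
Proof. by move=> p; exact: cvg_fst. Qed.

Lemma snd_continuous (X Y : topologicalType) : continuous (@snd X Y).
Proof. by move=> p; exact: cvg_snd. Qed.

Lemma comp_continuous (X Y Z : topologicalType) (f : X -> Y) (g : Y -> Z) :
  continuous f -> continuous g -> continuous (g \o f).
Proof. by move=> fc gc x; apply: continuous_comp; [exact: fc|exact: gc]. Qed.

Lemma pad_fst_continuous (R : realType) n (X : topologicalType) i :
  continuous (fun p : cube R n * X => pad p.1 i).
Proof.
exact: comp_continuous (@fst_continuous _ _) (@pad_continuous R _ i).
Qed.

Lemma closed_face (R : realType) n (X : topologicalType) (i : nat) (e : R) :
  closed [set p : cube R n * X | val (pad p.1 i) = e].
Proof.
have /continuous_closedP : continuous (fun p : cube R n * X => val (pad p.1 i)).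
  apply: (comp_continuous (f := fun p : cube R n * X => pad p.1 i)).
    exact: pad_fst_continuous.
  exact: set_val_continuous.
move=> /(_ [set e]); apply; exact: closed_eq.
Qed.

End Continuity.

Section ClosedSets.
Context (R : realType) (K : finGroupType) (C : smallcat).
Context (Fo : obj C -> kspace K) (Fm : hc_maps R Fo).
Hypothesis bC : bounded_chains C.
Hypothesis FmP : hc_diagram Fm.
Arguments Fm : clear implicits.

Lemma hoc_gen_class a b : hoc_gen Fm a b -> hoc_class Fm a = hoc_class Fm b.
Proof. by move=> ab; apply/hoc_classP; exact: rst_step. Qed.

Definition cell_set (S : set (hocolim Fm)) x s (c : nchain x s) :
    set (cube R (size s) * Fo x) :=
  [set p | S (hoc_class Fm (pre_cell Fo c (pad p.1) p.2))].

Lemma cell_setE (S : set (hocolim Fm)) x s (c : nchain x s) u (y : Fo x) :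
  cell_set S c (coords _ u, y) = S (hoc_class Fm (pre_cell Fo c u y)).
Proof. by rewrite /cell_set /= {1}/pre_cell coordsK. Qed.

(** This is the quotient topology of a coproduct; the component of the base point is discrete and
    imposes no condition. *)
Lemma closed_hocolimP (S : set (hocolim Fm)) :
  closed S <-> forall x s (c : nchain x s), closed (cell_set S c).
Proof.
have cellE x s (c : nchain x s) : cell_set S c =
    existT (hoc_cell R Fo) (Some (exist _ (x, s) c)) @^-1` (hoc_class Fm @^-1` S).
  apply/seteqP; split=> -[t y]; rewrite /cell_set /= /pre_cell coordsK //.
split=> [cS x s c|cS].
  rewrite cellE; have /continuous_closedP := @existT_continuous _ (hoc_cell R Fo)
    (Some (exist _ (x, s) c)); apply.
  have /continuous_closedP : continuous (hoc_class Fm) by exact: pi_continuous.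
  exact.
rewrite -openC; apply/sigT_openP => -[[[x s] c]|]; last exact: discrete_open.
by have := cS x s c; rewrite cellE -openC.
Qed.

(** On a face, membership in [S] is decided in a smaller cell through the continuous map [d], so the
    trace is a preimage under [d] cut with the closed face. The next two lemmas follow the same
    pattern. *)
Lemma cell_set_face0 (S : set (hocolim Fm)) x s1 s2 (c : nchain x (s1 ++ s2))
    (c2 : nchain (target x s1) s2) : (0 < size s1)%N ->
  closed (cell_set S c2) ->
  closed (cell_set S c `&` [set p | val (pad p.1 (size s1).-1) = 0]).
Proof.
move=> s1_gt0 cS2.
have c1 : nchain x s1 by move: c; rewrite nchain_cat => /andP[].
pose d (p : cube R (size (s1 ++ s2)) * Fo x) :=
  (coords (size s2) (dropc (size s1) (pad p.1)), Fm x s1 (coords _ (pad p.1)) p.2).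
have dc : continuous d.
  apply: pair_continuous.
    by apply: cube_continuous => i; exact: pad_fst_continuous.
  apply: (comp_continuous (f := fun p : cube R (size (s1 ++ s2)) * Fo x =>
      (coords (size s1).-1 (pad p.1), p.2)))
    (hc_continuous FmP c1 s1_gt0).
  apply: pair_continuous; last exact: snd_continuous.
  by apply: cube_continuous => i; exact: pad_fst_continuous.
rewrite (_ : _ `&` _ = d @^-1` (cell_set S c2) `&`
    [set p | val (pad p.1 (size s1).-1) = 0]).
  apply: closedI; last exact: closed_face.
  by have /continuous_closedP := dc; apply.
apply/seteqP; split=> -[t y] [] /= Sp t0; split=> //; move: Sp;
  rewrite /d /= cell_setE /cell_set /=;
  by rewrite (hoc_gen_class (hoc_face0 Fm c c2 y s1_gt0 t0)).
Qed.

Lemma cell_set_face1 (S : set (hocolim Fm)) x s1 f g s2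
    (c : nchain x (s1 ++ f :: g :: s2)) (c' : nchain x (s1 ++ ccomp g f :: s2)) :
  closed (cell_set S c') ->
  closed (cell_set S c `&` [set p | val (pad p.1 (size s1)) = 1]).
Proof.
move=> cS2.
pose d (p : cube R (size (s1 ++ f :: g :: s2)) * Fo x) :=
  (coords (size (s1 ++ ccomp g f :: s2)) (delc (size s1) (pad p.1)), p.2).
have dc : continuous d.
  apply: pair_continuous; last exact: snd_continuous.
  apply: cube_continuous => i; rewrite /coords /delc; case: (i < size s1)%N;
    exact: pad_fst_continuous.
rewrite (_ : _ `&` _ = d @^-1` (cell_set S c') `&`
    [set p | val (pad p.1 (size s1)) = 1]).
  apply: closedI; last exact: closed_face.
  by have /continuous_closedP := dc; apply.
apply/seteqP; split=> -[t y] [] /= Sp t1; split=> //; move: Sp;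
  rewrite /d /= cell_setE /cell_set /=;
  by rewrite (hoc_gen_class (hoc_face1 Fm c c' y t1)).
Qed.

Lemma cell_set_last (S : set (hocolim Fm)) x s f
    (c : nchain x (rcons s f)) (c' : nchain x s) :
  closed (cell_set S c') ->
  closed (cell_set S c `&` [set p | val (pad p.1 (size s)) = 1]).
Proof.
move=> cS2.
pose d (p : cube R (size (rcons s f)) * Fo x) := (coords (size s) (pad p.1), p.2).
have dc : continuous d.
  apply: pair_continuous; last exact: snd_continuous.
  apply: cube_continuous => i.
  exact: pad_fst_continuous.
rewrite (_ : _ `&` _ = d @^-1` (cell_set S c') `&`
    [set p | val (pad p.1 (size s)) = 1]).
  apply: closedI; last exact: closed_face.
  by have /continuous_closedP := dc; apply.
apply/seteqP; split=> -[t y] [] /= Sp t1; split=> //; move: Sp;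
  rewrite /d /= cell_setE /cell_set /=;
  by rewrite (hoc_gen_class (hoc_last Fm c c' y t1)).
Qed.

Lemma closed_basept (x : obj C) : closed [set basept (Fo x)].
Proof. exact/accessible_closed_set1/hausdorff_accessible/kspace_hausdorff. Qed.

(** All these points are one and the same in the quotient, so the set is empty or the whole closed
    preimage of the base point of F(x). *)
Lemma cell_set_base (S : set (hocolim Fm)) x s (c : nchain x s) :
  closed (cell_set S c `&` [set p | p.2 = basept (Fo x)]).
Proof.
have cb : closed [set p : cube R (size s) * Fo x | p.2 = basept (Fo x)].
  have /continuous_closedP := @snd_continuous (cube R (size s)) (Fo x).
  move=> /(_ [set basept (Fo x)]); apply; exact: closed_basept.
have bE (p : cube R (size s) * Fo x) : p.2 = basept (Fo x) ->
    cell_set S c p = S (hoc_class Fm (pre_pt R Fo)).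
  case: p => t y /= ->; rewrite /cell_set /=.
  by rewrite (hoc_gen_class (hoc_base Fm c (pad t))).
have [Sp|Sp] := pselect (S (hoc_class Fm (pre_pt R Fo))).
  rewrite (_ : _ `&` _ = [set p : cube R (size s) * Fo x | p.2 = basept (Fo x)]) //.
  by apply/seteqP; split=> [p []//|p /= pb]; split=> //; rewrite bE.
rewrite (_ : _ `&` _ = set0); first exact: closed0.
by apply/seteqP; split=> // p [/= + pb]; rewrite bE.
Qed.

(** A point of a cell that is not reduced lies over a base point or on one of finitely many faces,
    where the trace is closed by induction on the dimension; [D] has to catch the reduced points
    only. *)
Lemma closed_by_reduced (S : set (hocolim Fm)) :
  (forall x s (c : nchain x s), exists D : set (cube R (size s) * Fo x),
    [/\ closed D, D `<=` cell_set S c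
      & forall u y, reduced (pre_cell Fo c u y) ->
          cell_set S c (coords _ u, y) -> D (coords _ u, y)]) ->
  closed S.
Proof.
move=> HD; apply/closed_hocolimP.
suff cellP n : forall x s (c : nchain x s), (size s <= n)%N -> closed (cell_set S c).
  by move=> x s c; exact: cellP (leqnn _).
elim: n => [|n IH] x s c sn.
  have [D [cD DS SD]] := HD x s c.
  rewrite (_ : cell_set S c =
      D `|` (cell_set S c `&` [set p | p.2 = basept (Fo x)])).
    by apply: closedU => //; exact: cell_set_base.
  apply/seteqP; split=> [[t y] Sp|p [/DS//|[]//]].
  have [yb|/eqP yN] := eqVneq y (basept (Fo x)); [by right|left].
  rewrite -(coordsK t); apply: SD; rewrite ?coordsK //.
  by right=> // i /leq_trans/(_ sn).
have [D [cD DS SD]] := HD x s c.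
have f0 i : (i < size s)%N -> closed (cell_set S c `&` [set p | val (pad p.1 i) = 0]).
  move=> lis; have si := size_takel lis.
  have := cat_take_drop i.+1 s; move: si.
  move: (take i.+1 s) (drop i.+1 s) => s1 s2 si es; subst s.
  have /andP[_ c2] : nchain x s1 && nchain (target x s1) s2 by rewrite -nchain_cat.
  have -> : i = (size s1).-1 by rewrite si.
  apply: (cell_set_face0 (c2 := c2)); rewrite ?si //; apply: IH.
  by move: sn; rewrite size_cat si addSn ltnS; apply: leq_trans; exact: leq_addl.
have f1 i : (i < size s)%N -> closed (cell_set S c `&` [set p | val (pad p.1 i) = 1]).
  move=> lis; have [lis2|] := ltnP i.+1 (size s).
    have [s1 [f [g [s2 [es si]]]]] := size2_split lis2.
    subst s i.
    apply: (cell_set_face1 (c' := nchain_ccomp bC c)).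
    by apply: IH; move: sn; rewrite !size_cat /= addnS.
  case/lastP: s c sn lis {HD D cD DS SD f0} => // s f c sn lis si.
  rewrite size_rcons in sn; have -> : i = size s.
    rewrite size_rcons in lis; rewrite size_rcons in si.
    by apply/eqP; rewrite eqn_leq; apply/andP; split; [exact: lis|exact: si].
  have c' : nchain x s by move: c; rewrite -cats1 nchain_cat => /andP[].
  by apply: (cell_set_last (c' := c')); exact: IH.
rewrite (_ : cell_set S c = D `|` (cell_set S c `&` [set p | p.2 = basept (Fo x)])
  `|` \bigcup_(i in `I_(size s)) (cell_set S c `&` [set p | val (pad p.1 i) = 0])
  `|` \bigcup_(i in `I_(size s)) (cell_set S c `&` [set p | val (pad p.1 i) = 1])).
  do 2!(apply: closedU; last exact: closed_bigcup).
  by apply: closedU => //; exact: cell_set_base.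
apply/seteqP; split=> [[t y] Sp|p]; last first.
  by case=> [[[/DS//|[]//]|]|]; case=> ? _ [].
have [yb|/eqP yN] := eqVneq y (basept (Fo x)); first by left; left; right.
have [[i lis /eqP ui]|no0] := pselect (exists2 i, (i < size s)%N & val (pad t i) == 0).
  by left; right; exists i.
have [[i lis /eqP ui]|no1] := pselect (exists2 i, (i < size s)%N & val (pad t i) == 1).
  by right; exists i.
left; left; left; rewrite -(coordsK t); apply: SD; rewrite ?coordsK //.
right=> // i lis; split; apply/negP => ui; first by apply: no0; exists i.
by apply: no1; exists i.
Qed.

End ClosedSets.

(** * Cofibrations *)

Section UnitInterval.
Context {R : realType}.

Lemma clamp_subproof (x : R) :
  Num.max 0 (Num.min 1 x) \in (`[0%R, 1%R]%classic : set R).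
Proof.
apply/mem_set; rewrite /= in_itv /= le_max lexx /= ge_max ler01 /=.
by rewrite ge_min lexx.
Qed.

(** The retraction of the line onto the unit interval, so that times can be computed in [R]. *)
Definition clamp (x : R) : unitI R :=
  exist _ (Num.max 0 (Num.min 1 x)) (clamp_subproof x).

Lemma unitI_itv (s : unitI R) : 0 <= val s <= 1.
Proof. by case: s => x /= /set_mem; rewrite /= in_itv. Qed.

Lemma val_clamp (x : R) : 0 <= x <= 1 -> val (clamp x) = x.
Proof. by move=> /andP[x0 x1]; rewrite /= min_r // max_r. Qed.

Lemma clampK (s : unitI R) : clamp (val s) = s.
Proof. by apply/val_inj/val_clamp/unitI_itv. Qed.

Lemma clamp0 : clamp 0 = unitI0 R.
Proof. by apply/val_inj; rewrite val_clamp // lexx ler01. Qed.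

Lemma clamp_continuous : continuous clamp.
Proof.
apply: continuous_comp_initial => x; apply: continuous_max.
  exact: cst_continuous.
by apply: continuous_min; [exact: cst_continuous|exact: cvg_id].
Qed.

Lemma unitI_compact : compact [set: unitI R].
Proof.
have -> : [set: unitI R] = clamp @` `[0, 1]%classic.
  apply/seteqP; split=> // s _; exists (val s); last exact: clampK.
  by rewrite /= in_itv; exact: unitI_itv.
apply: continuous_compact; last exact: segment_compact.
exact/continuous_subspaceT/clamp_continuous.
Qed.

(** By compactness of [0,1], as in the tube lemma, [g (s, z')] is within [e] of [g (s, z)] uniformly
    in [s] for [z'] near [z]; the suprema then differ by at most [e]. *)
Lemma sup_unitI_continuous (Z : topologicalType) (g : unitI R * Z -> R) (M : R) :
  continuous g -> (forall p, g p <= M) ->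
  continuous (fun z => sup (range (fun s => g (s, z)))).
Proof.
move=> gc gM z; apply/cvgrPdist_le => e e0.
have hs z' : has_sup (range (fun s => g (s, z'))).
  split; first by exists (g (unitI0 R, z')), (unitI0 R).
  by exists M => _ [s _ <-]; exact: gM.
have nc : near_covering [set: unitI R] by apply/compact_near_coveringP/unitI_compact.
have near_le : \forall z' \near z,
    [set: unitI R] `<=` (fun s => `|g (s, z) - g (s, z')| <= e).
  apply: (nc Z (nbhs z) (fun z' s => `|g (s, z) - g (s, z')| <= e)) => s _.
  have := gc (s, z) => /cvgrPdist_le/(_ (e / 2)).
  move=> /(_ (divr_gt0 e0 (ltr0Sn R 1))) []/= [P Q] [/= sP zQ] PQ.
  exists (P, Q) => //= -[s' z'] [/= Ps' Qz'].
  have h1 := PQ (s', z') (conj Ps' Qz').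
  have h2 := PQ (s', z) (conj Ps' (nbhs_singleton zQ)).
  (* The time varies too: both [g (s', z')] and [g (s', z)] are within [e / 2] of [g (s, z)]. *)
  rewrite (_ : _ - _ = (g (s, z) - g (s', z')) - (g (s, z) - g (s', z))); last first.
    by rewrite opprB [RHS]addrC subrKA.
  by apply: (le_trans (ler_normB _ _)); rewrite [e]splitr lerD.
have le_sup z1 z2 : (forall s, g (s, z1) <= g (s, z2) + e) ->
    sup (range (fun s => g (s, z1))) <= sup (range (fun s => g (s, z2))) + e.
  move=> h; apply: ge_sup; first by have [] := hs z1.
  move=> _ [s _ <-]; apply: (le_trans (h s)); rewrite lerD2r.
  by apply: ub_le_sup; [have [] := hs z2|exists s].
apply: filterS near_le => z' zz'.
have h1 : sup (range (fun s => g (s, z))) <= sup (range (fun s => g (s, z'))) + e.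
  by apply: le_sup => s; have := zz' s I; rewrite ler_norml; lra.
have h2 : sup (range (fun s => g (s, z'))) <= sup (range (fun s => g (s, z))) + e.
  by apply: le_sup => s; have := zz' s I; rewrite ler_norml; lra.
by rewrite ler_norml; lra.
Qed.

Lemma cutoff_continuous (Z : topologicalType) (m : Z -> R) :
  continuous m -> continuous (fun a => Num.max 0 (1 - (m a + m a))).
Proof.
move=> mc a.
apply: (@continuous_max _ _ (fun=> 0) (fun a => 1 - (m a + m a))).
  exact: cst_continuous.
apply: cvgB; first exact: cst_continuous.
by apply: cvgD; exact: mc.
Qed.

End UnitInterval.

(** * Homotopy extension and retractions *)

Section Cofibrations.
Context {R : realType}.

Lemma cofibration_retraction (X : topologicalType) (A : set X) :
  cofibration R A ->
  exists r : unitI R * X -> unitI R * X,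
    [/\ continuous r, forall x, r (unitI0 R, x) = (unitI0 R, x),
        forall s x, A x -> r (s, x) = (s, x)
      & forall p, (r p).1 = unitI0 R \/ A (r p).2].
Proof.
(* The test space is [0 x X] together with [I x A], as a subspace of [I x X]; extending its two
   inclusions gives the retraction. *)
move=> cA; pose T := [set p : unitI R * X | p.1 = unitI0 R \/ A p.2].
have fP x : (unitI0 R, x) \in T by apply/mem_set; left.
have hP (p : unitI R * A) : (p.1, val p.2) \in T.
  by apply/mem_set; right; apply/set_mem/(valP p.2).
pose f x : T := SigSub (fP x); pose h p : T := SigSub (hP p).
have fc : continuous f.
  apply: continuous_comp_initial; apply: pair_continuous.
    exact: cst_continuous.
  by move=> x; exact: cvg_id.
have hc : continuous h.
  apply: continuous_comp_initial; apply: pair_continuous; first exact: fst_continuous.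
  exact: comp_continuous (@snd_continuous _ _) (@set_val_continuous _ _).
have [|h' [h'c h'f h'h]] := cA T f h fc hc; first by move=> a; apply/val_inj.
exists (fun p => val (h' p)); split.
- exact: comp_continuous h'c (@set_val_continuous _ _).
- by move=> x; rewrite h'f.
- by move=> s x Ax; have := h'h s (SigSub (mem_set Ax)) => /= ->.
- by move=> p; have /set_mem := valP (h' p).
Qed.

(** As [A] is closed, [f] and [h] paste along two closed pieces to a continuous [k], and [k] after
    the retraction is the extension. *)
Lemma retraction_cofibration (X : topologicalType) (A : set X)
    (r : unitI R * X -> unitI R * X) : closed A ->
  continuous r -> (forall x, r (unitI0 R, x) = (unitI0 R, x)) ->
  (forall s x, A x -> r (s, x) = (s, x)) ->
  (forall p, (r p).1 = unitI0 R \/ A (r p).2) -> cofibration R A.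
Proof.
move=> clA rc r0 rA rT Y f h fc hc fh.
pose T0 := [set p : unitI R * X | p.1 = unitI0 R].
pose T1 := [set p : unitI R * X | A p.2].
pose k (p : unitI R * X) : Y :=
  if pselect (A p.2) is left Ap then h (p.1, SigSub (mem_set Ap)) else f p.2.
have k0 x : k (unitI0 R, x) = f x.
  by rewrite /k; case: pselect => //= Ax; rewrite fh.
have k1 s (a : A) : k (s, val a) = h (s, a).
  rewrite /k; case: pselect => [Aa|[]]; last exact: set_mem (valP a).
  by congr (h (_, _)); exact/val_inj.
have clT0 : closed T0.
  have /continuous_closedP := @fst_continuous (unitI R) X.
  move=> /(_ [set unitI0 R]); apply.
  have /continuous_closedP := @set_val_continuous R `[0%R, 1%R]%classic.
  move=> /(_ [set 0]) cl; rewrite (_ : [set _] = set_val @^-1` [set 0 : R]).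
    by apply: cl; exact: closed_eq.
  by apply/seteqP; split=> [_ -> //|s s0]; exact/val_inj.
have clT1 : closed T1.
  by have /continuous_closedP := @snd_continuous (unitI R) X; apply.
have kc : {within T0 `|` T1, continuous k}.
  apply: withinU_continuous => //.
    apply/subspace_sigL_continuousP.
    rewrite (_ : sigL _ _ = (f \o snd) \o set_val).
      apply: comp_continuous; first exact: set_val_continuous.
      exact: comp_continuous (@snd_continuous _ _) fc.
    apply/funext => -[[s x] sx]; have s0 : s = unitI0 R := set_mem sx.
    by subst s; exact: k0.
  apply/subspace_sigL_continuousP.
  have aP (p : T1) : (val p).2 \in A by apply/mem_set/(set_mem (valP p)).
  rewrite (_ : sigL _ _ = h \o fun p : T1 => ((val p).1, SigSub (aP p) : A)).
    apply: comp_continuous hc; apply: pair_continuous.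
      exact: comp_continuous (@set_val_continuous _ _) (@fst_continuous _ _).
    apply: continuous_comp_initial.
    exact: comp_continuous (@set_val_continuous _ _) (@snd_continuous _ _).
  apply/funext => p; rewrite /= -k1 /sigL /=.
  by case: p {aP} => -[].
have rTP p : r p \in T0 `|` T1 by apply/mem_set; exact: rT.
exists (k \o r); split=> [|x|s a].
- have -> : k \o r = sigL (T0 `|` T1) k \o (fun p => SigSub (rTP p)).
    exact/funext.
  apply: comp_continuous; last exact/subspace_sigL_continuousP.
  exact: continuous_comp_initial.
- by rewrite /= r0 k0.
- by rewrite /= rA ?k1 //; exact: set_mem (valP a).
Qed.

Lemma cofibration_sub (X : topologicalType) (A B : set X) :
  closed B -> B `<=` A -> cofibration R A -> cofibration R B ->
  cofibration R (set_val @^-1` B : set A).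
Proof.
move=> clB BA /cofibration_retraction[rA [rAc rA0 rAA rAT]].
move=> /cofibration_retraction[rB [rBc rB0 rBB rBT]].
have [one one1] : exists one : unitI R, val one = 1.
  by exists (clamp 1); rewrite val_clamp // lexx ler01.
(* [g] measures how far the path under [rB] has left [A]: it vanishes in [A], and where [g < 1] the
   time coordinate of [rA] is nonzero, so that [rA] ends in [A]. *)
pose g (p : unitI R * A) : R := 1 - val (rA (one, (rB (p.1, val p.2)).2)).1.
have incc : continuous (fun p : unitI R * A => (p.1, val p.2)).
  apply: pair_continuous; first exact: fst_continuous.
  exact: comp_continuous (@snd_continuous _ _) (@set_val_continuous _ _).
have gc : continuous g.
  move=> p; rewrite /g; apply: cvgB; first exact: cst_continuous.
  move: p; apply: (comp_continuous (g := set_val)); last exact: set_val_continuous.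
  apply: (comp_continuous (g := fst)); last exact: fst_continuous.
  apply: (comp_continuous (g := rA)); last exact: rAc.
  apply: pair_continuous; first exact: cst_continuous.
  apply: (comp_continuous (g := snd)); last exact: snd_continuous.
  exact: comp_continuous incc rBc.
have g1 p : g p <= 1.
  by rewrite /g; have := unitI_itv (rA (one, (rB (p.1, val p.2)).2)).1; lra.
have gA s (a : A) : A (rB (s, val a)).2 -> g (s, a) = 0.
  by move=> Aa; rewrite /g /= rAA //= one1 subrr.
have gT s (a : A) : g (s, a) < 1 -> A (rA (one, (rB (s, val a)).2)).2.
  have [|//] := rAT (one, (rB (s, val a)).2).
  by rewrite /g /= => -> /=; rewrite subr0 ltxx.
(* The supremum over all times bounds [g] also at the stopped time [T], which is itself defined from
   [m]. *)
pose m (a : A) := sup (range (fun s => g (s, a))).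
have mc : continuous m by exact: sup_unitI_continuous gc g1.
have gm s a : g (s, a) <= m a.
  by apply: ub_le_sup; [exists 1 => _ [s' _ <-]; exact: g1|exists s].
(* [l] is 1 on [B], and [l a > 0] only if the whole path of [a] under [rB] stays
   where [rA (one, -)] ends in [A]. *)
pose l a := Num.max 0 (1 - (m a + m a)).
have lc : continuous l by exact: cutoff_continuous.
pose T (p : unitI R * A) := clamp (val p.1 * l p.2).
have Tc : continuous T.
  apply: (comp_continuous (g := clamp)); last exact: clamp_continuous.
  move=> p; apply: cvgM.
    move: p; exact: comp_continuous (@fst_continuous _ _) (@set_val_continuous _ _).
  by move: p; exact: comp_continuous (@snd_continuous _ _) lc.
(* If [m >= 1], then [l = 0]: the homotopy is stopped at time 0, and the point is still in [A]. *)
have gT1 p : g (T p, p.2) < 1.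
  have [m2|m2] := ltP (m p.2) 1; first exact: le_lt_trans (gm _ _) m2.
  have -> : T p = unitI0 R.
    by rewrite /T (_ : l p.2 = 0) ?mulr0 ?clamp0 // /l max_l //; lra.
  by rewrite gA ?ltr01 // rB0; exact: set_mem (valP p.2).
pose q p := rB (T p, val (p.2 : A)).
have qc : continuous q.
  apply: (comp_continuous (g := rB)) rBc; apply: pair_continuous => //.
  exact: comp_continuous (@snd_continuous _ _) (@set_val_continuous _ _).
have dP p : (rA (one, (q p).2)).2 \in A by apply/mem_set/gT/gT1.
(* Follow [rB] up to the stopped time, then push back into [A] by [rA (one, -)], keeping the time
   coordinate of [rB]; the push does not move points of [A], hence none of [B]. *)
pose r p : unitI R * A := ((q p).1, SigSub (dP p)).
have rE s (a : A) t : rB (T (s, a), val a) = (t, val a) -> r (s, a) = (t, a).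
  move=> e; congr pair; first by rewrite /q /= e.
  by apply/val_inj => /=; rewrite /q /= e /= rAA //; exact: set_mem (valP a).
apply: (retraction_cofibration (r := r)).
- by have /continuous_closedP := @set_val_continuous X A; apply.
- apply: pair_continuous; first exact: comp_continuous qc (@fst_continuous _ _).
  apply: continuous_comp_initial.
  apply: (comp_continuous (g := snd)); last exact: snd_continuous.
  apply: (comp_continuous (g := rA)) rAc; apply: pair_continuous.
    exact: cst_continuous.
  exact: comp_continuous qc (@snd_continuous _ _).
- by move=> a; apply: rE; rewrite /T /= mul0r clamp0 rB0.
- move=> s a Ba; apply: rE; rewrite rBB // /T /=.
  rewrite (_ : l a = 1) ?mulr1 ?clampK // /l.
  have g0 s' : g (s', a) = 0 by rewrite gA // rBB //; exact: BA.
  have -> : m a = 0.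
    suff e : range (fun s' => g (s', a)) = [set 0] by rewrite /m e sup1.
    apply/seteqP.
    by split=> [_ [s' _ <-]|_ ->]; [exact: g0|exists s; rewrite ?g0].
  by rewrite addr0 subr0 max_r.
- move=> p; have [|Bq] := rBT (T p, val p.2); [by left|right].
  change (B (rA (one, (q p).2)).2); rewrite rAA //; exact: BA.
Qed.

End Cofibrations.

(** * Fixed points *)

Section TopologicalComplements.

Lemma closed_fixpoints (X : topologicalType) (f : X -> X) :
  hausdorff_space X -> continuous f -> closed [set x | f x = x].
Proof.
move=> hX fc x xcl; apply: hX => U V fxU xV.
have fU : nbhs x (f @^-1` U) := fc x _ fxU.
have [y [/= fy [Uy Vy]]] := xcl _ (filterI fU xV).
by exists y; split=> //; rewrite -fy.
Qed.

(** The inclusion of [T x A] in [T x X] is a closed map because [A] is closed, and the set is the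
    image of [W]. *)
Lemma closed_prod_set_type (T X : topologicalType) (A : set X) (W : set (T * A)) :
  closed A -> closed W ->
  closed [set p : T * X | exists2 a : A, p.2 = val a & W (p.1, a)].
Proof.
move=> clA clW [t x] xcl.
have Ax : A x.
  apply: clA => U xU; have [|[t' x'] [[a /= -> _] [_ Ua]]] := xcl (setT `*` U).
    by exists (setT, U) => //; split=> //; exact: filterT.
  by exists (val a); split=> //; exact: set_mem (valP a).
exists (SigSub (mem_set Ax)) => //; apply: clW => /= N [[P Q] /= [tP xQ] PQ].
case: xQ => _ [[Q' oQ' <-] /= Q'x Q'Q].
have [|[t' x'] [[a /= -> Wa] [Pt' Q'a]]] := xcl (P `*` Q').
  by exists (P, Q') => //; split=> //; exact: open_nbhs_nbhs.
by exists (t', a); split=> //; apply: PQ; split=> //; exact: Q'Q.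
Qed.

End TopologicalComplements.

(** * Points over varying objects, and the wedge *)

Section TotalSpace.
Context {K : finGroupType} {C : smallcat} (Fo : obj C -> kspace K).

(** Replaces transport along an equality of objects: a function of the object and the point is
    evaluated on both sides. *)
Lemma tot_fun (T : Type) (f : forall x, Fo x -> T) x x' (y : Fo x) (y' : Fo x') :
  tot Fo y = tot Fo y' -> f x y = f x' y'.
Proof. by move=> /(congr1 (fun p => f (projT1 p) (projT2 p))). Qed.

Lemma tot_dom x x' (y : Fo x) (y' : Fo x') : tot Fo y = tot Fo y' -> x = x'.
Proof. exact: (@tot_fun _ (fun x _ => x)). Qed.

Lemma tot_kact k x x' (y : Fo x) (y' : Fo x') : tot Fo y = tot Fo y' ->
  tot Fo (kact k y) = tot Fo (kact k y').
Proof. exact: (@tot_fun _ (fun x y => tot Fo (kact k y))). Qed.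

Lemma tot_inw x x' (y : Fo x) (y' : Fo x') : tot Fo y = tot Fo y' ->
  inw y = inw y'.
Proof. exact: (@tot_fun _ (fun x y => inw y)). Qed.

Lemma tot_continuous (T : topologicalType) x x' (f : T -> Fo x) (g : T -> Fo x') :
  (forall t, tot Fo (f t) = tot Fo (g t)) -> continuous g -> continuous f.
Proof.
move=> fg gc t; have ex := tot_dom (fg t); move: t.
case: _ / ex g fg gc => g fg gc t.
by rewrite (_ : f = g) //; apply/funext => t'; exact: tot_inj (fg t').
Qed.

Lemma tot_hc_maps (R : realType) (Fm : hc_maps R Fo) x x' (y : Fo x) (y' : Fo x')
    s s' (u u' : nat -> unitI R) :
  tot Fo y = tot Fo y' -> s = s' -> (forall i, (i < (size s).-1)%N -> u i = u' i) ->
  tot Fo (Fm x s (coords _ u) y) = tot Fo (Fm x' s' (coords _ u') y').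
Proof.
move=> yy <- uu; rewrite (_ : coords _ u = coords _ u').
  exact: (@tot_fun _ (fun x y => tot Fo (Fm x s (coords _ u') y))).
by apply/funext => i; exact: uu.
Qed.

(** The retraction of the wedge onto one summand, collapsing the others; it brings the action, which
    is continuous on the wedge, back to F(c). *)
Definition wedge_proj (c : obj C) : wedgeF Fo -> Fo c :=
  wedge_fun (fun d (y : Fo d) =>
    if pselect (d = c) is left e then ecast d (Fo d) e y else basept (Fo c)).

Lemma wedge_proj_compat (c i j : obj C) :
  (if pselect (i = c) is left e then ecast d (Fo d) e (basept (Fo i))
   else basept (Fo c)) =
  (if pselect (j = c) is left e then ecast d (Fo d) e (basept (Fo j))
   else basept (Fo c)).
Proof.
suff base i' : (if pselect (i' = c) is left e
    then ecast d (Fo d) e (basept (Fo i')) else basept (Fo c)) = basept (Fo c).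
  by rewrite !base.
by case: pselect => // e; case: _ / e.
Qed.

Lemma wedge_proj_continuous c : continuous (wedge_proj c).
Proof.
apply: wedge_fun_continuous; last exact: wedge_proj_compat.
move=> d; case: pselect => [e|_]; last exact: cst_continuous.
by case: _ / e => y; exact: cvg_id.
Qed.

Lemma wedge_projE c (y : Fo c) : wedge_proj c (inw y) = y.
Proof.
rewrite /wedge_proj wedge_lift_funE; last exact: wedge_proj_compat.
by case: pselect => // e; rewrite (eq_irrelevance e (erefl c)).
Qed.

Lemma wedge_projN c d (y : Fo d) : d <> c -> wedge_proj c (inw y) = basept (Fo c).
Proof.
move=> dc; rewrite /wedge_proj wedge_lift_funE; last exact: wedge_proj_compat.
by case: pselect.
Qed.

End TotalSpace.

Section FixedPoints.
Context (R : realType) (G K : finGroupType) (C : smallcat).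
Context (A : cat_action G C) (H : {group G}).
Context (Fo : obj C -> kspace K) (Fm : hc_maps R Fo) (E : ext_action A Fm).
Arguments Fm : clear implicits.

(** Equality in the wedge is weaker than equality in the total space at base points only, and there
    the invariance of [u] closes the gap. *)
Lemma ffixP u (y : Fo u) : inv_obj A H u ->
  ffix E H u y <-> forall h, h \in H -> tot Fo (wcomp E h y) = tot Fo y.
Proof.
move=> /inv_objP uH; split=> yH h hH.
  have := yH h hH; rewrite wact_inw => /inw_eq[//|[-> ->]].
  by apply: tot_basept_eq; exact: uH.
by rewrite wact_inw; apply: tot_inw; exact: yH.
Qed.

Lemma closed_ffix u : closed (ffix E H u).
Proof.
rewrite (_ : ffix E H u = \bigcap_(h in [set h | h \in H])
    [set y | wedge_proj u (wact E h (inw y)) = y]).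
  apply: closed_bigI => h _; apply: closed_fixpoints; first exact: kspace_hausdorff.
  apply: (comp_continuous (g := wedge_proj u)); last exact: wedge_proj_continuous.
  apply: (comp_continuous (g := wact E h)); last exact: wact_continuous.
  exact: wedge_lift_continuous.
apply/seteqP; split=> y yH h /= hH; first by rewrite yH // wedge_projE.
have := yH h hH; rewrite /= wact_inw.
(* If [h] moves [u], then [h y] lies in another summand and projects to the base point, so [y] is
   the base point, which is fixed. *)
have [e|ne] := pselect (aobj A h u = u); last first.
  by rewrite wedge_projN // => <-; rewrite -wact_inw wact_basept.
move: (wcomp E h y) => z; case: _ / (esym e) z => z.
by rewrite wedge_projE => ->.
Qed.

Lemma closed_kfix (X : kspace K) (L : {group K}) : closed (kfix (X := X) L).
Proof.
rewrite (_ : kfix L = \bigcap_(k in [set k | k \in L]) [set y : X | kact k y = y]) //.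
apply: closed_bigI => k _; apply: closed_fixpoints; first exact: kspace_hausdorff.
exact: kact_continuous.
Qed.

(** The trivial subgroup [L] shows that F(u)^H is itself a cofibration in F(u); [cofibration_sub]
    then passes from F(u) to F(u)^H. *)
Lemma KTop_fixed_space u : KTop R (Fo u) ->
  (forall L : {group K}, cofibration R (ffix E H u `&` kfix (X := Fo u) L)) ->
  KTop R (fixed_space E H u).
Proof.
move=> [base_cof _] fix_cof.
have fix1 : cofibration R (ffix E H u).
  rewrite (_ : ffix E H u = ffix E H u `&` kfix (X := Fo u) 1%G) //.
  apply/esym/setIidPl => y _ k /set1P ->; exact: kact1.
split=> [|L].
- rewrite (_ : [set _] = (set_val : ffix E H u -> Fo u) @^-1` [set basept (Fo u)]).
    apply: cofibration_sub => //; first exact: closed_basept.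
    by move=> _ -> h _; exact: wact_basept.
  by apply/seteqP; split=> [_ -> //|y yb]; exact/val_inj.
rewrite (_ : kfix (X := fixed_space E H u) L = (set_val : ffix E H u -> Fo u) @^-1`
    (ffix E H u `&` kfix (X := Fo u) L)).
  apply: cofibration_sub => //.
  by apply: closedI; [exact: closed_ffix|exact: closed_kfix].
apply/seteqP; split=> [y yL|y [_ yL] k kL].
  by split=> [|k kL]; [exact: set_mem (valP y)|exact: (congr1 val (yL k kL))].
by apply/val_inj; exact: yL.
Qed.

End FixedPoints.

(** * The homotopy coherent diagram F^H *)

Section FixedDiagram.
Context (R : realType) (G K : finGroupType) (C : smallcat).
Context (A : cat_action G C) (H : {group G}).
Context (Fo : obj C -> kspace K) (Fm : hc_maps R Fo) (E : ext_action A Fm).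
Hypothesis FmP : hc_diagram Fm.
Hypothesis bC : bounded_chains C.
Arguments Fm : clear implicits.

Local Notation CH := (fixed_cat A H).
Local Notation FH := (fixed_diag E H).
Local Notation vo := (@fobj_val G C A H).
Local Notation vm := (@fmor_val G C A H).

Lemma fobj_val_inj : injective vo.
Proof. exact: val_inj. Qed.

Lemma fmor_val_inj : injective vm.
Proof. exact: val_inj. Qed.

Lemma fobj_val_inv (x : obj CH) : inv_obj A H (vo x).
Proof. exact: (valP (x : {x : obj C | inv_obj A H x})). Qed.

Lemma fmor_val_inv (f : mor CH) : inv_mor A H (vm f).
Proof. exact: (valP (f : {f : mor C | inv_mor A H f})). Qed.

Lemma fmor_val_comp (g f : mor CH) : cod f = dom g ->
  vm (ccomp g f) = ccomp (vm g) (vm f).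
Proof.
move=> /(congr1 vo) e; rewrite /fmor_val /= val_insubd.
by rewrite (inv_comp e (fmor_val_inv g) (fmor_val_inv f)).
Qed.

Lemma fobj_val_target (x : obj CH) s : vo (target x s) = target (vo x) (map vm s).
Proof. by elim: s x => // f s IH x; exact: IH (cod f). Qed.

Lemma nchain_fmor_val (x : obj CH) s : nchain (vo x) (map vm s) = nchain x s.
Proof.
rewrite /nchain; congr (_ && _).
  elim: s x => // f s IH x; congr andb; exact: IH (cod f).
rewrite all_map; apply: eq_all => f /=.
by rewrite -(inj_eq fmor_val_inj).
Qed.

Lemma map_amor_fmor_val h (s : seq (mor CH)) : h \in H ->
  map (amor A h) (map vm s) = map vm s.
Proof.
move=> hH; rewrite -map_comp; apply: eq_map => f /=.
by have /inv_morP := fmor_val_inv f; exact.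
Qed.

Lemma bounded_fixed_cat : bounded_chains C -> bounded_chains CH.
Proof.
move=> [N HN]; exists N => x s; rewrite -nchain_fmor_val => /HN.
by rewrite size_map.
Qed.

Lemma fixed_val_inj u : injective (@fixed_val R G K C A Fo Fm E H u).
Proof. by move=> y z; exact: val_inj. Qed.

Lemma tot_fixed (x x' : obj CH) (y : FH x) (y' : FH x') :
  tot Fo (fixed_val y) = tot Fo (fixed_val y') -> tot FH y = tot FH y'.
Proof.
move=> e; have /fobj_val_inj ex := tot_dom e.
by case: _ / ex y' e => y' /tot_inj/fixed_val_inj ->.
Qed.

Lemma fixed_val_ffix (x : obj CH) (y : FH x) : ffix E H (vo x) (fixed_val y).
Proof. exact: set_mem (valP (y : set_type (ffix E H (vo x)))). Qed.

(** The compatibility of the external action turns [h F(f)(y)] into [F(h f)(h y)], and both the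
    arrows and [y] are fixed by [h]. *)
Lemma hc_maps_ffix (x : obj CH) s (u : nat -> unitI R) (y : FH x) :
  nchain x s -> (0 < size s)%N ->
  exists z : FH (target x s), tot Fo (fixed_val z) =
    tot Fo (Fm (vo x) (map vm s) (coords _ u) (fixed_val y)).
Proof.
move=> c s0; set w := Fm _ _ _ _.
have cv : nchain (vo x) (map vm s) by rewrite nchain_fmor_val.
have sv : (0 < size (map vm s))%N by rewrite size_map.
have wH h : h \in H -> tot Fo (wcomp E h w) = tot Fo w.
  move=> hH; rewrite /w wcomp_hc //; apply: tot_hc_maps => //.
    by have /(ffixP E _ (fobj_val_inv x)) := fixed_val_ffix y; exact.
  exact: map_amor_fmor_val.
have e := fobj_val_target x s; move: w wH; case: _ / e => w wH.
have wF : ffix E H (vo (target x s)) w.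
  by apply/(ffixP E _ (fobj_val_inv _)); exact: wH.
by exists (SigSub (mem_set wF)).
Qed.

(* The target of [Fm] is equal to [Fo (vo (target x s))] only propositionally:
   the value is the unique point with the right [tot], see [fixed_mapsE]. *)
Definition fixed_maps : hc_maps R FH := fun x s t y =>
  if pselect (exists z : FH (target x s), tot Fo (fixed_val z) =
      tot Fo (Fm (vo x) (map vm s) (coords _ (pad t)) (fixed_val y)))
  is left e then sval (cid e) else basept (FH (target x s)).

Arguments fixed_maps : clear implicits.

Lemma fixed_mapsE (x : obj CH) s t (y : FH x) : nchain x s -> (0 < size s)%N ->
  tot Fo (fixed_val (fixed_maps x s t y)) =
  tot Fo (Fm (vo x) (map vm s) (coords _ (pad t)) (fixed_val y)).
Proof.
move=> c s0; rewrite /fixed_maps; case: pselect => [e|[]]; first by case: cid.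
exact: hc_maps_ffix.
Qed.

Lemma fixed_maps_coords (x : obj CH) s (u : nat -> unitI R) (y : FH x) :
  nchain x s -> (0 < size s)%N ->
  tot Fo (fixed_val (fixed_maps x s (coords _ u) y)) =
  tot Fo (Fm (vo x) (map vm s) (coords _ u) (fixed_val y)).
Proof.
move=> c s0; rewrite fixed_mapsE //; apply: tot_hc_maps => // i.
by rewrite size_map; exact: pad_coords.
Qed.

Lemma fixed_val_continuous u : continuous (@fixed_val R G K C A Fo Fm E H u).
Proof. exact: set_val_continuous. Qed.

(** The inclusions F(u)^H -> F(u) are jointly injective on total spaces, by [tot_fixed], so each
    identity is inherited from F; continuity holds because F(u)^H has the initial topology. *)
Lemma fixed_diagP : hc_diagram fixed_maps.
Proof.
split.
- move=> x s c s0; apply: continuous_comp_initial.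
  apply: (@tot_continuous _ _ _ _ _ _ _ (fun p : cube R (size s).-1 * FH x =>
    Fm (vo x) (map vm s) (coords _ (pad p.1)) (fixed_val p.2))).
    by move=> p; exact: fixed_mapsE.
  have cv : nchain (vo x) (map vm s) by rewrite nchain_fmor_val.
  have sv : (0 < size (map vm s))%N by rewrite size_map.
  apply: (comp_continuous (f := fun p : cube R (size s).-1 * FH x =>
    (coords _ (pad p.1), fixed_val p.2))) (hc_continuous FmP cv sv).
  apply: pair_continuous.
    by apply: cube_continuous => i; exact: pad_fst_continuous.
  exact: comp_continuous (@snd_continuous _ _) (@fixed_val_continuous _).
- move=> x s t k y c s0; apply: (@tot_inj _ _ FH); apply: tot_fixed.
  rewrite fixed_mapsE //.
  rewrite (_ : fixed_val (kact k y) = kact k (fixed_val y)) //.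
  rewrite hc_equivariant ?nchain_fmor_val ?size_map //.
  by apply/esym/(@tot_kact _ _ Fo k); exact: fixed_mapsE.
- move=> x s t c s0; apply: (@tot_inj _ _ FH); apply: tot_fixed.
  rewrite fixed_mapsE // (_ : fixed_val (basept (FH x)) = basept _) //.
  rewrite hc_basept ?nchain_fmor_val ?size_map //.
  by apply: tot_basept_eq; rewrite fobj_val_target.
- move=> x s1 s2 u y c s10 s20 us; apply: tot_fixed.
  have /andP[c1 c2] : nchain x s1 && nchain (target x s1) s2 by rewrite -nchain_cat.
  rewrite !fixed_maps_coords // ?size_cat ?addn_gt0 ?s10 //.
  transitivity (tot Fo (Fm (vo x) (map vm s1 ++ map vm s2) (coords _ u)
      (fixed_val y))).
    by apply: tot_hc_maps; rewrite ?map_cat.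
  have cv : nchain (vo x) (map vm s1 ++ map vm s2).
    by rewrite -map_cat nchain_fmor_val.
  rewrite (hc_face0 FmP) ?size_map //; apply: tot_hc_maps => //.
    by apply/esym; exact: fixed_maps_coords.
  by move=> i _; rewrite size_map.
- move=> x s1 f g s2 u y c us; apply: tot_fixed.
  have cfg : cod f = dom g.
    by move: c; rewrite nchain_cat => /andP[_ /andP[/and3P[_ /eqP]]].
  have gfE : map vm (s1 ++ ccomp g f :: s2) =
      map vm s1 ++ ccomp (vm g) (vm f) :: map vm s2.
    by rewrite map_cat /= fmor_val_comp.
  have fgE : map vm (s1 ++ f :: g :: s2) =
      map vm s1 ++ vm f :: vm g :: map vm s2 by rewrite map_cat.
  have c' := nchain_ccomp (bounded_fixed_cat bC) c.
  rewrite !fixed_maps_coords // ?size_cat ?addnS //.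
  transitivity (tot Fo (Fm (vo x) (map vm s1 ++ vm f :: vm g :: map vm s2)
      (coords _ u) (fixed_val y))); first exact: tot_hc_maps.
  rewrite (hc_face1 FmP) -?fgE ?nchain_fmor_val ?size_map //.
  by apply: tot_hc_maps.
Qed.

End FixedDiagram.

(** * The homotopy colimit of the fixed diagram *)

Section PreCells.
Context {R : realType} {K : finGroupType} {C : smallcat} {Fo : obj C -> kspace K}.

Lemma hoc_pre_cases (a : hoc_pre R Fo) :
  a = pre_pt R Fo \/ exists x s (c : nchain x s) u y, a = pre_cell Fo c u y.
Proof.
case: a => -[[[x s] c] [t y]|[]]; [right|by left].
by exists x, s, c, (pad t), y; rewrite /pre_cell coordsK.
Qed.

(** All the data of a point in a non-dependent form, used to invert equalities between cells. *)
Definition cell_data (a : hoc_pre R Fo) :=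
  let: existT o b := a in
  match o return hoc_cell R Fo o -> option ({x : obj C & Fo x} * seq (mor C * R)) with
  | Some c => fun b => Some (tot Fo b.2, labels (val c).2 (pad b.1))
  | None => fun _ => None
  end b.

Lemma pre_cell_neq_pt x s (c : nchain x s) (u : nat -> unitI R) (y : Fo x) :
  pre_cell Fo c u y <> pre_pt R Fo.
Proof. by move=> /(congr1 cell_data). Qed.

Lemma pre_cell_inj x s (c : nchain x s) (u : nat -> unitI R) (y : Fo x)
    x' s' (c' : nchain x' s') (u' : nat -> unitI R) (y' : Fo x') :
  pre_cell Fo c u y = pre_cell Fo c' u' y' ->
  [/\ tot Fo y = tot Fo y', s = s' & forall i, (i < size s)%N -> u i = u' i].
Proof.
move=> /(congr1 cell_data)/Some_inj/pair_equal_spec[yy /labels_inj[ss uu]].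
have es : s = s' := ss; split=> // i lis.
by have := uu i lis; rewrite /= !pad_coords // -es.
Qed.

End PreCells.

(** * The comparison map from hocolim F^H to (hocolim F)^H *)

Section FixedHocolim.
Context (R : realType) (G K : finGroupType) (C : smallcat).
Context (A : cat_action G C) (H : {group G}).
Context (Fo : obj C -> kspace K) (Fm : hc_maps R Fo) (E : ext_action A Fm).
Hypothesis FmP : hc_diagram Fm.
Hypothesis bC : bounded_chains C.
Arguments Fm : clear implicits.

Local Notation CH := (fixed_cat A H).
Local Notation FH := (fixed_diag E H).
Local Notation vo := (@fobj_val G C A H).
Local Notation vm := (@fmor_val G C A H).
Local Notation FmH := (@fixed_maps R G K C A H Fo Fm E).

Lemma nchain_fixed (x : obj CH) s : nchain x s -> nchain (vo x) (map vm s).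
Proof. by rewrite nchain_fmor_val. Qed.

Definition pre_incl (a : hoc_pre R FH) : hoc_pre R Fo :=
  let: existT o b := a in
  match o return hoc_cell R FH o -> hoc_pre R Fo with
  | Some c => fun b => pre_cell Fo (nchain_fixed (valP c)) (pad b.1) (fixed_val b.2)
  | None => fun _ => pre_pt R Fo
  end b.

Lemma pre_inclE (x : obj CH) s (c : nchain x s) (c' : nchain (vo x) (map vm s))
    u (y : FH x) : pre_incl (pre_cell FH c u y) = pre_cell Fo c' u (fixed_val y).
Proof.
by apply: pre_cell_eq => // i; rewrite size_map; exact: pad_coords.
Qed.

(** The maps and composites of F^H restrict those of F, so each generating relation goes to one of
    the same kind. *)
Lemma pre_incl_gen a b : hoc_gen FmH a b -> hoc_gen Fm (pre_incl a) (pre_incl b).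
Proof.
case=> [x s1 s2 c c2 u y s10 us|x s1 f g s2 c c' u y us|x s f c c' u y us|x s c u].
- have cv : nchain (vo x) (map vm s1 ++ map vm s2).
    by rewrite -map_cat nchain_fmor_val.
  have c2v : nchain (target (vo x) (map vm s1)) (map vm s2).
    by move: cv; rewrite nchain_cat => /andP[].
  have c1 : nchain x s1 by move: c; rewrite nchain_cat => /andP[].
  rewrite !(pre_inclE _ (nchain_fixed _)).
  have -> : pre_cell Fo (nchain_fixed c) u (fixed_val y) =
      pre_cell Fo cv u (fixed_val y) by apply: pre_cell_eq; rewrite ?map_cat.
  have -> : pre_cell Fo (nchain_fixed c2) (dropc (size s1) u)
        (fixed_val (FmH (coords _ u) y)) =
      pre_cell Fo c2v (dropc (size (map vm s1)) u)
        (Fm (vo x) (map vm s1) (coords _ u) (fixed_val y)).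
    apply: pre_cell_eq => //; first by move=> i _; rewrite size_map.
    exact: fixed_maps_coords.
  by apply: hoc_face0; rewrite size_map.
- have cfg : cod f = dom g.
    by move: c; rewrite nchain_cat => /andP[_ /andP[/and3P[_ /eqP]]].
  have cv : nchain (vo x) (map vm s1 ++ vm f :: vm g :: map vm s2).
    by have := nchain_fixed c; rewrite map_cat.
  have gfE : map vm (s1 ++ ccomp g f :: s2) =
      map vm s1 ++ ccomp (vm g) (vm f) :: map vm s2.
    by rewrite map_cat /= fmor_val_comp.
  have cv' : nchain (vo x) (map vm s1 ++ ccomp (vm g) (vm f) :: map vm s2).
    by rewrite -gfE nchain_fmor_val.
  rewrite !(pre_inclE _ (nchain_fixed _)).
  have -> : pre_cell Fo (nchain_fixed c) u (fixed_val y) =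
      pre_cell Fo cv u (fixed_val y) by apply: pre_cell_eq; rewrite ?map_cat.
  have -> : pre_cell Fo (nchain_fixed c') (delc (size s1) u) (fixed_val y) =
      pre_cell Fo cv' (delc (size (map vm s1)) u) (fixed_val y).
    by apply: pre_cell_eq => // i _; rewrite size_map.
  by apply: hoc_face1; rewrite size_map.
- have cv : nchain (vo x) (rcons (map vm s) (vm f)).
    by rewrite -map_rcons nchain_fmor_val.
  rewrite !(pre_inclE _ (nchain_fixed _)).
  have -> : pre_cell Fo (nchain_fixed c) u (fixed_val y) =
      pre_cell Fo cv u (fixed_val y) by apply: pre_cell_eq; rewrite ?map_rcons.
  by apply: hoc_last; rewrite size_map.
- by rewrite (pre_inclE _ (nchain_fixed c)); exact: hoc_base.
Qed.

Lemma pre_incl_equiv a b : clos_refl_sym_trans _ (hoc_gen FmH) a b ->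
  clos_refl_sym_trans _ (hoc_gen Fm) (pre_incl a) (pre_incl b).
Proof.
elim=> [? ? /pre_incl_gen|?|? ? _|? b' ? _ ? _]; first exact: rst_step.
- exact: rst_refl.
- exact: rst_sym.
- exact: rst_trans.
Qed.

Lemma reduced_pre_incl a : reduced a -> reduced (pre_incl a).
Proof.
case=> [|x s c u y us yN]; first exact: reduced_pt.
rewrite (pre_inclE _ (nchain_fixed c)); apply: reduced_cell => [i|yb].
  by rewrite size_map; exact: us.
by apply: yN; apply: fixed_val_inj; rewrite yb.
Qed.

Lemma pre_incl_inj : injective pre_incl.
Proof.
move=> a b; case: (hoc_pre_cases a) => [->|[x [s [c [u [y ->]]]]]];
  case: (hoc_pre_cases b) => [->|[x' [s' [c' [u' [y' ->]]]]]] //;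
  rewrite ?(pre_inclE _ (nchain_fixed c)) ?(pre_inclE _ (nchain_fixed c')).
move=> /pre_cell_inj[/tot_fixed yy /(inj_map (@fmor_val_inj _ _ _ _)) ss].
by rewrite size_map => uu; exact: pre_cell_eq.
Qed.

Definition hoc_incl (p : hocolim FmH) : hocolim Fm :=
  hoc_class Fm (pre_incl (hoc_repr p)).

Lemma hoc_inclE a : hoc_incl (hoc_class FmH a) = hoc_class Fm (pre_incl a).
Proof.
by apply/hoc_classP/pre_incl_equiv/hoc_classP; exact: hoc_reprK.
Qed.

Lemma hoc_class_reduced (D : smallcat) (Do : obj D -> kspace K) (Dm : hc_maps R Do)
    (p : hocolim Dm) : bounded_chains D ->
  exists2 a, reduced a & p = hoc_class Dm a.
Proof.
move=> bD; have [b rb ab] := exists_reduced Dm bD (hoc_repr p).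
by exists b => //; rewrite -(hoc_reprK p); apply/hoc_classP.
Qed.

Lemma hoc_class_reduced_inj a b : reduced a -> reduced b ->
  hoc_class Fm a = hoc_class Fm b -> a = b.
Proof.
by move=> ra rb /hoc_classP/(nf_equiv FmP); exact: reduced_inj.
Qed.

(** Reduced representatives go to reduced ones, which their class determines, and [pre_incl] is
    injective before passing to the quotient. *)
Lemma hoc_incl_inj : injective hoc_incl.
Proof.
move=> p q; have [a ra ->] := hoc_class_reduced p (bounded_fixed_cat A H bC).
have [b rb ->] := hoc_class_reduced q (bounded_fixed_cat A H bC).
rewrite !hoc_inclE => /hoc_class_reduced_inj ab; congr hoc_class.
by apply: pre_incl_inj; apply: ab; exact: reduced_pre_incl.
Qed.

Lemma pre_gact_pre_incl h a : h \in H -> pre_gact E h (pre_incl a) = pre_incl a.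
Proof.
move=> hH; case: (hoc_pre_cases a) => [->|[x [s [c [u [y ->]]]]]] //.
rewrite (pre_inclE _ (nchain_fixed c)).
rewrite (pre_gactE E _ _ _ (nchain_amor A h (nchain_fixed c))).
apply: pre_cell_eq => //; first exact: map_amor_fmor_val.
by have /(ffixP E _ (fobj_val_inv x)) := fixed_val_ffix y; exact.
Qed.

Lemma hoc_incl_fix p : hoc_fix E H (hoc_incl p).
Proof.
move=> h hH; rewrite -(hoc_reprK p) hoc_inclE -hoc_gactE //.
by rewrite pre_gact_pre_incl.
Qed.

Lemma reduced_gact h a : reduced a -> reduced (pre_gact E h a).
Proof.
case=> [|x s c u y us yN]; first exact: reduced_pt.
rewrite (pre_gactE E _ _ _ (nchain_amor A h c)); apply: reduced_cell => [i|yb].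
  by rewrite size_map; exact: us.
(* If [h y] were the base point, applying the inverse of [h] would make [y] the base point. *)
apply: yN; have := wact1 E (inw y); rewrite -(mulVg h) wactM wact_inw yb.
by rewrite wact_basept => /esym/inw_eq[/esym/eq_tot_basept|[]//]; exact.
Qed.

(** By uniqueness, H fixes the reduced representative and not only its class; hence its object,
    arrows and point are H-invariant and form a cell of F^H. *)
Lemma hoc_incl_surj p : hoc_fix E H p -> exists q, hoc_incl q = p.
Proof.
have [a ra ->] := hoc_class_reduced p bC => aH.
have {}aH h : h \in H -> pre_gact E h a = a.
  move=> hH; apply: hoc_class_reduced_inj => //; first exact: reduced_gact.
  by rewrite hoc_gactE // aH.
case: ra aH => [_|x s c u y us yN aH]; first
  by exists (hoc_class FmH (pre_pt R _)); rewrite hoc_inclE.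
have {}aH h : h \in H -> tot Fo (wcomp E h y) = tot Fo y /\ map (amor A h) s = s.
  by move=> /aH; rewrite (pre_gactE E _ _ _ (nchain_amor A h c)) => /pre_cell_inj[].
have xH : inv_obj A H x.
  by apply/inv_objP => h /aH[/tot_dom].
have [s' es] : exists s' : seq (mor CH), map vm s' = s.
  have : all (inv_mor A H) s.
    apply/allP => f fs; apply/inv_morP => h /aH[_].
    by rewrite -[RHS]map_id => /eq_in_map; exact.
  elim: (s) => [|f l IH /= /andP[fH /IH[l' <-]]]; first by exists [::].
  by exists ((exist _ f fH : {f : mor C | inv_mor A H f}) :: l').
pose x' : obj CH := exist _ x xH : {x : obj C | inv_obj A H x}.
subst s; have c' : nchain x' s' by rewrite -nchain_fmor_val.
have yF : ffix E H x y by apply/ffixP => // h /aH[].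
exists (hoc_class FmH (pre_cell FH c' u (SigSub (mem_set yF) : FH x'))).
by rewrite hoc_inclE (pre_inclE (x := x') _ c).
Qed.

Lemma hoc_incl_kact k p : hoc_incl (hoc_kact k p) = hoc_kact k (hoc_incl p).
Proof.
rewrite -(hoc_reprK p) -(hoc_kactE (fixed_diagP H E FmP bC)) !hoc_inclE -hoc_kactE //.
congr hoc_class; case: (hoc_repr p) => -[[[x s] c] [t y]|[]] //.
Qed.

Lemma hoc_incl_continuous : continuous hoc_incl.
Proof.
apply/continuous_closedP => S clS; apply/closed_hocolimP => x s c.
pose d (p : cube R (size s) * FH x) :=
  (coords (size (map vm s)) (pad p.1), fixed_val p.2).
have dc : continuous d.
  apply: pair_continuous.
    by apply: cube_continuous => i; exact: pad_fst_continuous.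
  exact: comp_continuous (@snd_continuous _ _)
    (@fixed_val_continuous _ _ _ _ _ _ _ _ _ _).
rewrite (_ : cell_set _ c = d @^-1` cell_set S (nchain_fixed c)).
  have /continuous_closedP := dc; apply.
  by have /closed_hocolimP := clS; exact.
apply/funext => -[t y]; rewrite /preimage /d /= cell_setE /cell_set /=.
by rewrite hoc_inclE (pre_inclE _ (nchain_fixed c)).
Qed.

Lemma hoc_incl_closed (B : set (hocolim FmH)) : closed B -> closed (hoc_incl @` B).
Proof.
move=> clB; apply: (closed_by_reduced bC FmP) => x s c.
have redP u y : reduced (pre_cell Fo c u y) ->
    (hoc_incl @` B) (hoc_class Fm (pre_cell Fo c u y)) ->
    exists x' s' (c' : nchain x' s') u' (y' : FH x'),
      B (hoc_class FmH (pre_cell FH c' u' y')) /\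
      pre_incl (pre_cell FH c' u' y') = pre_cell Fo c u y.
  move=> rc [q]; have [b rb ->] := hoc_class_reduced q (bounded_fixed_cat A H bC).
  rewrite hoc_inclE => Bb /hoc_class_reduced_inj => /(_ (reduced_pre_incl rb) rc).
  case: (hoc_pre_cases b) Bb => [-> _ /esym/pre_cell_neq_pt//|].
  by move=> [x' [s' [c' [u' [y' ->]]]]] ? ?; exists x', s', c', u', y'.
(* Over a chain that does not come from C^H the image has no reduced points, so the empty set serves
   as [D]. *)
have [[x' [s' [xx ss]]]|none] :=
  pselect (exists (x' : obj CH) (s' : seq (mor CH)), vo x' = x /\ map vm s' = s);
  last first.
  exists set0; split=> //; first exact: closed0.
  move=> u y rc; rewrite cell_setE => /(redP _ _ rc)[x' [s' [c' [u' [y' [_]]]]]].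
  rewrite (pre_inclE _ (nchain_fixed c')) => /pre_cell_inj[/tot_dom xx ss _].
  by apply: none; exists x', s'.
subst x s; have c' : nchain x' s' by rewrite -nchain_fmor_val.
pose e (p : cube R (size (map vm s')) * FH x') := (coords (size s') (pad p.1), p.2).
have ec : continuous e.
  apply: pair_continuous; last exact: snd_continuous.
  by apply: cube_continuous => i; exact: pad_fst_continuous.
(* Here [D] is the trace of [B] on the corresponding cell of F^H, included in the cell of F; it is
   closed because F(u)^H is closed in F(u). *)
exists [set p | exists2 y : FH x',
  p.2 = fixed_val y & (e @^-1` cell_set B c') (p.1, y)].
split.
- apply: (@closed_prod_set_type _ _ (ffix E H (vo x'))); first exact: closed_ffix.
  have /continuous_closedP := ec; apply.
  by have /closed_hocolimP := clB; exact.
- move=> -[t _] [y /= -> ]; rewrite /preimage /e /= cell_setE => By.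
  exists (hoc_class FmH (pre_cell FH c' (pad t) y)) => //.
  by rewrite hoc_inclE (pre_inclE _ c).
- move=> u y rc; rewrite cell_setE => /(redP _ _ rc).
  move=> [x'' [s'' [c'' [u' [y' [By]]]]]].
  rewrite (pre_inclE _ (nchain_fixed c'')) => /pre_cell_inj[yy ss uu].
  have ex : x'' = x' by apply: fobj_val_inj; exact: tot_dom yy.
  have es : s'' = s' by apply: inj_map ss; exact: fmor_val_inj.
  subst x'' s''; exists y'; first by rewrite (tot_inj yy).
  rewrite /preimage /e /= cell_setE.
  rewrite (_ : pre_cell FH c' _ y' = pre_cell FH c'' u' y') //.
  apply: pre_cell_eq => // i lis; rewrite pad_coords ?size_map // uu //.
  by rewrite size_map.
Qed.

Lemma hoc_incl_homeomorphism :
  exists phi : hocolim FmH -> set_type (hoc_fix E H),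
    homeomorphism phi /\ forall p, set_val (phi p) = hoc_incl p.
Proof.
pose phi p : set_type (hoc_fix E H) := SigSub (mem_set (hoc_incl_fix p)).
have surj (q : set_type (hoc_fix E H)) : exists p, hoc_incl p = val q.
  exact: hoc_incl_surj (set_mem (valP q)).
pose psi q := sval (cid (surj q)).
have psiK q : hoc_incl (psi q) = val q by rewrite /psi; case: cid.
exists phi; split=> //; split.
  apply: continuous_comp_initial; exact: hoc_incl_continuous.
exists psi; split.
- apply/continuous_closedP => B clB.
  (* Continuity of the inverse is the closedness of [hoc_incl]. *)
  rewrite (_ : psi @^-1` B = set_val @^-1` (hoc_incl @` B)).
    have /continuous_closedP := @set_val_continuous _ (hoc_fix E H); apply.
    exact: hoc_incl_closed.
  apply/seteqP; split=> q /=; first by exists (psi q).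
  by move=> [p Bp pq]; have -> : psi q = p by apply: hoc_incl_inj; rewrite psiK.
- by move=> p; apply: hoc_incl_inj; rewrite psiK.
- by move=> q; apply/val_inj; exact: psiK.
Qed.

End FixedHocolim.

(** The values of [phi] on the base point and on all cells identify it as the map induced by the
    inclusions F(u)^H -> F(u). The spaces F(u)^H are shown to be in K-Top_* when their L-fixed
    points are cofibrations in F(u) for all subgroups [L] of K. *)
Theorem lemma5p6 (R : realType) (G K : finGroupType) (C : smallcat)
    (A : cat_action G C) (H : {group G})
    (Fo : obj C -> kspace K) (Fm : hc_maps R Fo) (E : ext_action A Fm) :
  bounded_chains C ->
  abelian [set: K]%SET ->
  (forall x, KTop R (Fo x)) ->
  hc_diagram Fm ->
  exists FmH : hc_maps R (fixed_diag E H),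
  [/\ forall (x : obj (fixed_cat A H)) (s : seq (mor (fixed_cat A H)))
        (u : nat -> unitI R) (y : fixed_diag E H x),
        nchain x s -> (0 < size s)%N ->
        tot Fo (fixed_val (FmH x s (coords _ u) y)) =
        tot Fo (Fm (fobj_val x) (map (@fmor_val _ _ A H) s) (coords _ u)
                  (fixed_val y)),
      hc_diagram FmH,
      (forall (x : obj (fixed_cat A H)) (L : {group K}),
         cofibration R (ffix E H (fobj_val x) `&` kfix (X := Fo (fobj_val x)) L)) ->
        forall x, KTop R (fixed_diag E H x)
    & exists phi : hocolim FmH -> set_type (hoc_fix E H),
      [/\ homeomorphism phi,
          set_val (phi (hoc_class FmH (pre_pt R _))) =
            hoc_class Fm (pre_pt R Fo),
          forall (x : obj (fixed_cat A H)) (s : seq (mor (fixed_cat A H)))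
            (c : nchain x s)
            (c' : nchain (fobj_val x) (map (@fmor_val _ _ A H) s))
            (u : nat -> unitI R) (y : fixed_diag E H x),
            set_val (phi (hoc_class FmH (pre_cell (fixed_diag E H) c u y))) =
            hoc_class Fm (pre_cell Fo c' u (fixed_val y))
        & forall (k : K) (p : hocolim FmH),
            set_val (phi (hoc_kact k p)) = hoc_kact k (set_val (phi p))]].
Proof.
move=> bC _ FoK FmP; exists (@fixed_maps R G K C A H Fo Fm E); split.
- by move=> x s u y; exact: fixed_maps_coords.
- exact: fixed_diagP.
- by move=> cof x; apply: KTop_fixed_space => // L; exact: cof.
have [phi [phi_homeo phiE]] := hoc_incl_homeomorphism H E FmP bC.
exists phi; split=> //.
- by rewrite phiE hoc_inclE.
- by move=> x s c c' u y; rewrite phiE hoc_inclE // (pre_inclE _ c').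
- by move=> k p; rewrite !phiE hoc_incl_kact.
Qed.
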